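(* Let $I\subset\mathbf k[\mathbf x]$ be a monomial ideal with cofinite support and $x_i\notin I$ for all $i$, and let $\alpha\in\mathcal R(I)$ be a root. Then the image $\iota_\alpha(N(\alpha))$ is a generalized root subgroup of $\operatorname{Aut}_{\mathbf k}(\mathbf k[\mathbf x]/I)$ with respect to the maximal torus $T$ if and only if one of the following holds: (i) $\alpha$ is outer; or (ii) $\alpha$ is inner and, setting $E_\alpha^+=\{e_k\in E_\alpha : \alpha_k\neq 0\}$, either (ii.1) $E_{2\alpha}=\varnothing$; or (ii.2) $E_{2\alpha}=E_\alpha^+=\{e_{i_0}\}$ for some index $i_0$.
   Context: Setting: $\mathbf k$ is an algebraically closed field of characteristic zero, $n\ge1$, $M=\mathbb Z^n$ with canonical basis $E=\{e_1,\dots,e_n\}$, and $N_{\mathbf k}=\operatorname{Hom}(M,\mathbf k)\cong\mathbf k^n$ with dual basis $e_1^*,\dots,e_n^*$. $\mathbf k[\mathbf x]=\mathbf k[x_1,\dots,x_n]$ and $\mathbf x^m=x_1^{m_1}\cdots x_n^{m_n}$. For a monomial ideal $I$, $\operatorname{supp}(I)=\{m\in\mathbb Z^n_{\ge0}:\mathbf x^m\in I\}$; $I$ has cofinite support if $\mathbb Z^n_{\ge0}\setminus\operatorname{supp}(I)$ is finite. Set $A=\mathbf k[\mathbf x]/I$. Derivations: for $\alpha\in\mathbb Z^n$ and $p\in N_{\mathbf k}$, $\partial_{\alpha,p}$ denotes the homogeneous derivation $\mathbf x^m\mapsto p(m)\mathbf x^{m+\alpha}$ of $\mathbf k[\mathbf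 x]$ (whenever it maps $\mathbf k[\mathbf x]$ to itself), and $\overline\partial_{\alpha,p}$ the derivation induced on $A$ when $\partial_{\alpha,p}(I)\subseteq I$. A degree $\alpha$ is inner if $\alpha\in\mathbb Z_{\ge0}^n$ and outer otherwise. Roots: for $\alpha\in\mathbb Z^n$ put $E_\alpha=\{e_i\in E : \alpha+e_i\in\mathbb Z^n_{\ge0}\setminus\operatorname{supp}(I)\}$. A root is a degree $\alpha\ne0$ for which there is a nonzero homogeneous derivation of $A$ of degree $\alpha$; $\mathcal R(I)$ is the set of roots. Explicitly, an inner $\alpha\neq 0$ is a root iff $E_\alpha\neq\varnothing$; an outer $\alpha$ is a root iff it has exactly one negative coordinate, say $\alpha_k=-1$, for every $\beta\in\operatorname{supp}(I)$ either $\alpha+\beta\in\operatorname{supp}(I)$ or $\alpha+\beta\notin\mathbb Z^n_{\ge0}$, and $E_\alpha\ne\varnothing$ (then $E_\alpha=\{e_k\}$). For an inner root, $N(\alpha)=\bigoplus_{e_i\in E_\alpha}\mathbf k e_i^*$; for an outer root with negative coordinate $\alpha_k=-1$, $N(\alpha)=\mathbf k e_k^*$. The group $\operatorname{Aut}_{\mathbf k}(A)$ is a linear algebraic group with maximal torus $T$ acting by $\overline x_i\mapsto t_i\overline x_i$. For a root $\alpha$, $\iota_\alpha\colon N(\alpha)\to\operatorname{Aut}_{\mathbf k}(A)$ is $p\mapsto\exp(\overline\partial_{\alpha,p})$. A generalized root subgroup of an algebraic group $G$ with respect to a subgroup $H$ is a closed subgroup of $G$ isomorphic to $\mathbb G_a^m$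 for some $m\in\mathbb N$ which is normalized by $H$, with $H$ acting on it through a single character. *)

(* Defs.v *)
From HB Require Import structures.
From mathcomp Require Import all_boot all_order all_algebra all_field.
From mathcomp Require Import mpoly.

Set Implicit Arguments.
Unset Strict Implicit.
Unset Printing Implicit Defensive.

Import GRing.Theory Num.Theory.
Local Open Scope ring_scope.
Local Open Scope quotient_scope.

Section MonomialIdeals.
Variables (k : fieldType) (n : nat).
Implicit Type I : {pred {mpoly k[n]}}.

Definition isupp I : {pred 'X_{1..n}} := [pred m | 'X_[m] \in I].

(* I is the ideal generated by the monomials x^m, m \in S, for some S *)
Definition monomial_ideal I :=
  exists S : {pred 'X_{1..n}}, forall p, p \in I <->
    exists2 r : seq ({mpoly k[n]} * 'X_{1..n}),
      all (fun u => u.2 \in S) r & p = \sum_(u <- r) u.1 * 'X_[u.2].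

Definition cofinite_support I :=
  exists s : seq 'X_{1..n}, forall m, m \notin isupp I -> m \in s.

(* An [idealr] is proper by definition (it does not contain 1). *)
Record cofMonIdeal := CofMonIdeal {
  cmi_ideal :> idealr {mpoly k[n]};
  cmi_monomial : monomial_ideal cmi_ideal;
  cmi_cofinite : cofinite_support cmi_ideal
}.

End MonomialIdeals.

Section QuotientAlgebra.
Variables (k : fieldType) (n : nat) (I : cofMonIdeal k n).
Local Notation P := {mpoly k[n]}.
Local Notation J := (I : {pred P}).

Definition mquot : Type := {ideal_quot I}.

HB.instance Definition _ := Choice.on mquot.
HB.instance Definition _ := GRing.ComNzRing.copy mquot {ideal_quot I}.

Definition mproj : P -> mquot := \pi_{ideal_quot I}.
Definition mrepr : mquot -> P := fun a => repr (a : {ideal_quot I}).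

Lemma mreprK : cancel mrepr mproj.
Proof. by move=> a; rewrite /mproj /mrepr reprK. Qed.

Lemma mproj_eq p q : (mproj p == mproj q) = (p - q \in J).
Proof. by rewrite /mproj -Quotient.idealrBE. Qed.

Fact mproj_is_zmod_morphism : zmod_morphism mproj.
Proof. by move=> p q; rewrite /mproj; exact: (raddfB (\pi_{ideal_quot I})). Qed.
HB.instance Definition _ :=
  GRing.isZmodMorphism.Build P mquot mproj mproj_is_zmod_morphism.
Fact mproj_is_monoid_morphism : monoid_morphism mproj.
Proof.
by split=> [|p q]; rewrite /mproj ?(rmorph1 (\pi_{ideal_quot I}))
  ?(rmorphM (\pi_{ideal_quot I})).
Qed.
HB.instance Definition _ :=
  GRing.isMonoidMorphism.Build P mquot mproj mproj_is_monoid_morphism.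

Definition mscale (c : k) (a : mquot) : mquot := mproj c%:MP * a.

Fact mscaleA c d a : mscale c (mscale d a) = mscale (c * d) a.
Proof. by rewrite /mscale mulrA -rmorphM /= mpolyCM. Qed.
Fact mscale1 : left_id 1 mscale.
Proof. by move=> a; rewrite /mscale mpolyC1 rmorph1 mul1r. Qed.
Fact mscaleDr : right_distributive mscale +%R.
Proof. by move=> c a b; rewrite /mscale mulrDr. Qed.
Fact mscaleDl a : {morph mscale^~ a : c d / c + d}.
Proof. by move=> c d; rewrite /mscale mpolyCD rmorphD mulrDl. Qed.
HB.instance Definition _ :=
  GRing.Zmodule_isLmodule.Build k mquot mscaleA mscale1 mscaleDr mscaleDl.

Fact mscaleAl (c : k) (a b : mquot) : c *: (a * b) = (c *: a) * b.
Proof. exact: mulrA. Qed.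
HB.instance Definition _ := GRing.Lmodule_isLalgebra.Build k mquot mscaleAl.
HB.instance Definition _ := GRing.Lalgebra_isComAlgebra.Build k mquot.

Fact mproj_is_scalable : scalable mproj.
Proof. by move=> c p; rewrite -mul_mpolyC rmorphM. Qed.
HB.instance Definition _ :=
  GRing.isScalable.Build k P mquot *:%R mproj mproj_is_scalable.

Lemma isuppD m m' : m \in isupp I -> (m + m')%MM \in isupp I.
Proof. by rewrite !inE addmC mpolyXD; exact: idealMr. Qed.

Lemma ideal_coefP p :
  reflect (forall m, m \in msupp p -> m \in isupp I) (p \in J).
Proof.
apply: (iffP idP) => [|h]; last first.
  rewrite (mpolyE p) big_seq; apply: rpred_sum => m /h mI.
  by rewrite -mul_mpolyC idealMr.
have [S hS] := cmi_monomial I.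
have SI m : m \in S -> m \in isupp I.
  move=> mS; apply/hS; exists [:: (1, m)]; first by rewrite /= mS.
  by rewrite big_seq1 mul1r.
move=> /hS[r rS ->] m; elim: r rS => [|u r IH] /= => [_|/andP[uS rS]].
  by rewrite big_nil msupp0.
rewrite big_cons => /msuppD_le; rewrite mem_cat => /orP[|/(IH rS)//].
rewrite (perm_mem (msuppMX _ _)) => /mapP[m' _ ->].
by apply: isuppD; apply: SI.
Qed.

Fact cofinite_degree :
  exists d, [forall m : 'X_{1..n < d.+1}, (mdeg m == d) ==> (bmnm m \in isupp I)].
Proof.
have [s hs] := cmi_cofinite I.
exists (\max_(m <- s) mdeg m).+1; apply/forallP=> m; apply/implyP=> /eqP dm.
apply: contraT => /hs ms.
have := @leq_bigmax_seq _ s predT (fun m : 'X_{1..n} => mdeg m) _ ms isT.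
by rewrite dm ltnn.
Qed.

Definition cmi_degree := xchoose cofinite_degree.

Lemma cmi_degreeP m : (cmi_degree <= mdeg m)%N -> m \in isupp I.
Proof.
move: {2}(mdeg m) (erefl (mdeg m)) => e; elim: e m => [|e IH] m dm.
  rewrite dm leqn0 => /eqP d0.
  have mb : (mdeg m < cmi_degree.+1)%N by rewrite dm.
  move/forallP/(_ (BMultinom mb)): (xchooseP cofinite_degree).
  by rewrite /= dm -/cmi_degree d0 eqxx.
rewrite leq_eqVlt => /orP[/eqP dE|]; last first.
  rewrite dm ltnS => de.
  have /existsP[i mi] : [exists i, m i != 0%N].
    apply: contra_eqT dm; rewrite negb_exists => /forallP m0.
    rewrite mdegE big1 // => i _; apply/eqP.
    by move: (m0 i); rewrite negbK.
  have mE : (m = (m - U_(i)) + U_(i))%MM by rewrite submK // lep1mP.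
  have d' : mdeg (m - U_(i))%MM = e.
    by move: dm; rewrite {1}mE mdegD mdeg1 addn1 => -[].
  by rewrite mE; apply: isuppD; apply: IH; rewrite d'.
have mb : (mdeg m < cmi_degree.+1)%N by rewrite -dE.
move/forallP/(_ (BMultinom mb)): (xchooseP cofinite_degree).
by rewrite /= -dE eqxx.
Qed.

Definition cmi_basis : seq 'X_{1..n} :=
  [seq bmnm m | m <- enum [pred m : 'X_{1..n < cmi_degree} | bmnm m \notin isupp I]].

Lemma cmi_basis_uniq : uniq cmi_basis.
Proof. by rewrite map_inj_uniq ?enum_uniq //; exact: val_inj. Qed.

Lemma mem_cmi_basis m : (m \in cmi_basis) = (m \notin isupp I).
Proof.
apply/mapP/idP => [[m' + ->]|mI]; first by rewrite mem_enum.
have md : (mdeg m < cmi_degree)%N.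
  by rewrite ltnNge; apply: contra mI; exact: cmi_degreeP.
by exists (BMultinom md); rewrite ?mem_enum.
Qed.

Definition mquot_coord (a : mquot) : 'rV[k]_(size cmi_basis) :=
  \row_i (mrepr a)@_(tnth (in_tuple cmi_basis) i).

Lemma mquot_coord_proj p i :
  mquot_coord (mproj p) 0 i = p@_(tnth (in_tuple cmi_basis) i).
Proof.
rewrite mxE; apply/eqP; rewrite -subr_eq0 -mcoeffB; apply: contraT => c0.
have /ideal_coefP/(_ (tnth (in_tuple cmi_basis) i)) :
  mrepr (mproj p) - p \in J by rewrite -mproj_eq mreprK.
have := mem_tnth i (in_tuple cmi_basis); rewrite mem_cmi_basis => /negbTE ->.
by rewrite mcoeff_msupp c0 => /(_ isT).
Qed.

Fact mquot_coord_linear : linear mquot_coord.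
Proof.
move=> c a b; apply/rowP => i; rewrite -[a]mreprK -[b]mreprK -linearP.
by rewrite !mquot_coord_proj mcoeffD mcoeffZ [in RHS]mxE [in RHS]mxE !mquot_coord_proj.
Qed.

Fact mquot_coord_bij : bijective mquot_coord.
Proof.
pose g (v : 'rV[k]_(size cmi_basis)) :=
  mproj (\sum_i v 0 i *: 'X_[tnth (in_tuple cmi_basis) i]).
have gK : cancel g mquot_coord.
  move=> v; apply/rowP=> i; rewrite mquot_coord_proj raddf_sum /= (bigD1 i) //=.
  rewrite mcoeffZ mcoeffX eqxx mulr1 big1 ?addr0 // => j ji.
  rewrite mcoeffZ mcoeffX (tnth_nth 0%MM) (tnth_nth 0%MM).
  rewrite nth_uniq ?cmi_basis_uniq ?ltn_ord // (inj_eq val_inj).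
  by rewrite (negbTE ji) mulr0.
exists g => // a; rewrite -[RHS]mreprK; apply/eqP; rewrite /g mproj_eq.
apply/ideal_coefP => m; apply: contraTT; rewrite -mem_cmi_basis => mB.
have /tnthP[i ->] : m \in in_tuple cmi_basis by [].
rewrite mcoeff_msupp negbK mcoeffB -mquot_coord_proj -/(g _) gK mxE subrr //.
Qed.

HB.instance Definition _ := Lmodule_hasFinDim.Build k mquot
  (exist2 _ _ mquot_coord mquot_coord_linear mquot_coord_bij).
HB.instance Definition _ := Algebra_isFalgebra.Build k mquot.

End QuotientAlgebra.

(* Linear algebraic groups are given as subsets of GL(V) inside 'End(V), with *)
(* the matrix entries in a fixed basis of V as affine coordinates.            *)
Section LinearAlgebraicGroups.
Variables (k : fieldType) (V : vectType k).
Implicit Types (G H U : 'End(V) -> Prop) (f g h u : 'End(V)).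

Definition End_mx f : 'M[k]_(\dim {:V}) := passmx.mxof (vbasis {:V}) (vbasis {:V}) f.
Definition End_coord f : 'I_(\dim {:V} * \dim {:V}) -> k :=
  fun i => mxvec (End_mx f) 0 i.

Definition subgroup_of G U :=
  [/\ forall u, U u -> G u, U \1%VF,
      forall u v, U u -> U v -> U (u \o v)%VF &
      forall u, U u -> U (u^-1)%VF].

(* Every closed subset of GL(V) is cut out by polynomials in the matrix       *)
(* entries alone: denominators, which are powers of det, can be cleared.      *)
Definition zariski_closed_in G U :=
  exists S : {mpoly k[\dim {:V} * \dim {:V}]} -> Prop,
    forall f, U f <-> G f /\ forall P, S P -> P.@[End_coord f] = 0.

(* For U closed in GL(V), k[U] is the restriction to U of                     *)
(* k[GL(V)] = k[entries, 1/det].                                              *)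
Definition regular_on U (c : 'End(V) -> k) :=
  exists (P : {mpoly k[\dim {:V} * \dim {:V}]}) (r : nat),
    forall f, U f -> c f = P.@[End_coord f] / \det (End_mx f) ^+ r.

Definition alg_character H (chi : 'End(V) -> k) :=
  [/\ regular_on H chi, forall h, H h -> chi h != 0 &
      forall h1 h2, H h1 -> H h2 -> chi (h1 \o h2)%VF = chi h1 * chi h2].

(* phi is an isomorphism of algebraic groups from Ga^r (= k^r) onto U *)
Definition Ga_power_iso U r (phi : 'rV[k]_r -> 'End(V)) :=
  [/\ exists P : 'I_(\dim {:V} * \dim {:V}) -> {mpoly k[r]},
        forall v i, End_coord (phi v) i = (P i).@[v 0],
      forall v, U (phi v),
      forall v w, phi (v + w) = (phi v \o phi w)%VF &
      exists psi : 'End(V) -> 'rV[k]_r,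
        [/\ forall i, regular_on U (fun u => psi u 0 i), cancel phi psi &
            forall u, U u -> phi (psi u) = u]].

Definition gen_root_subgroup G H U :=
  [/\ subgroup_of G U, zariski_closed_in G U,
      forall h u, H h -> U u -> U (h \o u \o h^-1)%VF &
      exists (r : nat) (phi : 'rV[k]_r -> 'End(V)) (chi : 'End(V) -> k),
        [/\ Ga_power_iso U phi, alg_character H chi &
            forall h v, H h -> (h \o phi v \o h^-1)%VF = phi (chi h *: v)]].

(* The exponential series of a nilpotent D stops before degree dim V. *)
Definition nilp_exp (D : 'End(V)) : 'End(V) :=
  \sum_(j < \dim {:V}) (j`!%:R)^-1 *: iter j (comp_lfun D) \1%VF.

End LinearAlgebraicGroups.

Section Degrees.
Variables (k : fieldType) (n : nat).
Local Notation M := {ffun 'I_n -> int}.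
Implicit Types (a b : M) (m : 'X_{1..n}) (p : 'rV[k]_n).

Definition inner a := [forall i, 0 <= a i].
Definition outer a := ~~ inner a.

Definition e_ (i : 'I_n) : M := [ffun j => (j == i)%:Z].
Definition mnm_deg m : M := [ffun i => (m i)%:Z].
Definition deg_mnm a : 'X_{1..n} := [multinom absz (a i) | i < n].

(* x^a, with the convention that it is 0 when a has a negative coordinate *)
Definition Xdeg a : {mpoly k[n]} := if inner a then 'X_[deg_mnm a] else 0.

(* N_k = Hom(M, k) is 'rV[k]_n through the dual basis: e_i^* is delta_mx 0 i. *)
Definition N_pair p a : k := \sum_i p 0 i *~ a i.

(* The derivation x^m |-> p(m) x^(m + a) whenever the latter preserves k[x],  *)
(* i.e. whenever p(m) = 0 for all m >= 0 such that m + a is not >= 0.         *)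
Definition hder a p (q : {mpoly k[n]}) : {mpoly k[n]} :=
  \sum_(m <- msupp q) (q@_m * N_pair p (mnm_deg m)) *: Xdeg (mnm_deg m + a).

End Degrees.

Section Roots.
Variables (k : fieldType) (n : nat) (I : cofMonIdeal k n).
Local Notation A := (mquot I).
Local Notation M := {ffun 'I_n -> int}.
Implicit Types (a b : M) (p : 'rV[k]_n).

(* The component of degree b of the M-graded algebra A. *)
Definition mquot_piece b : {vspace A} := <[mproj I (Xdeg k b)]>%VS.

Definition derivation (D : 'End(A)) := forall x y, D (x * y) = D x * y + x * D y.

Definition homogeneous a (D : 'End(A)) :=
  forall b, (D @: mquot_piece b <= mquot_piece (b + a)%R)%VS.

Definition is_root a :=
  a != 0 /\ exists D : 'End(A), [/\ derivation D, homogeneous a D & D != 0].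

(* E_a, with e_i identified with its index i. *)
Definition Eset a : {set 'I_n} :=
  [set i | inner (a + e_ i) && (deg_mnm (a + e_ i) \notin isupp I)].

Definition Eset_plus a : {set 'I_n} := [set i in Eset a | a i != 0].

Definition Nspace a : {vspace 'rV[k]_n} :=
  if inner a then (\sum_(i in Eset a) <[delta_mx 0%R i]>)%VS
  else (\sum_(i | (a i == -1)%R) <[delta_mx 0%R i]>)%VS.

(* Meaningful when hder a p preserves I. *)
Definition hder_quot a p : 'End(A) :=
  linfun (fun x : A => mproj I (hder a p (mrepr x))).

Definition iota_ a p : 'End(A) := nilp_exp (hder_quot a p).

Definition iota_image a : 'End(A) -> Prop :=
  fun g => exists2 p, p \in Nspace a & g = iota_ a p.

Definition Aut_alg : 'End(A) -> Prop :=
  fun f => lker f == 0%VS /\ ahom_in {:A} f.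

Definition max_torus : 'End(A) -> Prop :=
  fun f => Aut_alg f /\ exists t : 'I_n -> k,
    forall i, t i != 0 /\ f (mproj I 'X_i) = t i *: mproj I 'X_i.

End Roots.

Arguments iota_ {k n} I a p.
Arguments iota_image {k n} I a _.
Arguments Aut_alg {k n} I _.
Arguments max_torus {k n} I _.

(* Main.v *)
From HB Require Import structures.
Require Import Defs.
From mathcomp Require Import all_boot all_order all_algebra all_field.
From mathcomp Require Import mpoly.

Import GRing.Theory Num.Theory passmx.
Local Open Scope ring_scope.

Set Implicit Arguments.
Unset Strict Implicit.
Unset Printing Implicit Defensive.

(** Write D_p for the derivation of degree alpha that sends x^m to
    p(m) x^(m + alpha), and x_i for the images of the variables in A.  The
    whole statement is governed by the commutators [D_p, D_q] with p, q in
    N(alpha).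

    Since alpha is nonzero, the monomials x^(m + j alpha) are pairwise distinct,
    and A has finite dimension, so D_p is nilpotent ([shifts_nilpotent]) and
    exp D_p is an algebra automorphism ([nilp_exp_ahom]).  If the D_p commute,
    then p |-> exp D_p is a homomorphism ([nilp_expD]).  It is polynomial in p,
    and it has a left inverse that is linear in the matrix entries: the
    coordinate p_i is the coefficient of x^(alpha + e_i) in exp(D_p) x_i
    ([bcoef_iota]).  This left inverse gives the isomorphism with a power of
    the additive group, and also the closedness of the image, which is the set
    of the u that equal the exponential of their own coordinates.  A torus
    element t conjugates D_p into t^alpha D_p ([torus_conj_hder]), so the torus
    acts through the single character t^alpha ([iota_image_gen_root]).

    Conversely, a power of the additive group is commutative; comparing, in
    exp(D_p) exp(D_q) x_i = exp(D_q) exp(D_p) x_i, the coefficients of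
    x^(2 alpha + e_i) gives [D_p, D_q] x_i = 0 ([iota_comm_hder]).

    It remains to see when the D_p commute.  For an outer root N(alpha) is a
    line, and they do.  For an inner root [D_p, D_q] is a derivation, hence it
    is determined by its values
      [D_p, D_q] x_i = (q_i p(alpha) - p_i q(alpha)) x^(2 alpha + e_i),
    and only the indices i in E_(2 alpha) matter.  If i is such an index, and j
    is another index in E_alpha, then the choice p = e_i^*, q = e_j^* forces
    alpha_j = 0: thus E_alpha^+ is contained in {i} ([inner_gen_root_vanishing]).
    On the other hand, if alpha_l > 0 then alpha + e_l divides 2 alpha + e_i, so
    that l lies in E_alpha^+, which is therefore not empty.  Hence as soon as
    E_(2 alpha) is nonempty, E_alpha^+ = {i} for every i in it
    ([Eset2_combinatorics]).  In that case p(alpha) = alpha_i p_i on N(alpha),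
    and the displayed coefficient vanishes identically ([inner_comm]). *)

(** * Exponentials of nilpotent operators *)

Section Exponential.
Variable k : fieldType.
Hypothesis char0 : [pchar k] =i pred0.

Lemma natr_succ_neq0 s : s.+1%:R != 0 :> k.
Proof. by move/pcharf0P: char0 => ->. Qed.

(** A double sum supported on a square is regrouped along the antidiagonals
    i + j = s, all of which are met for s < N + N. *)
Lemma sum_triangle (V : nmodType) (F : nat -> nat -> V) N :
    (forall i j, (N <= i)%N || (N <= j)%N -> F i j = 0) ->
  \sum_(s < N + N) \sum_(i < s.+1) F i (s - i)%N = \sum_(i < N) \sum_(j < N) F i j.
Proof.
move=> F0.
transitivity (\sum_(0 <= s < N + N) \sum_(0 <= i < N + N | (i <= s)%N) F i (s - i)%N).
  rewrite big_mkord; apply: eq_bigr => s _.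
  by rewrite -(big_mkord xpredT (fun i => F i (s - i)%N)) (big_nat_widen 0 s.+1 (N + N)).
rewrite (exchange_big_dep_nat predT) //=.
have colE i : \sum_(0 <= s < N + N | (i <= s)%N) F i (s - i)%N =
    \sum_(0 <= j < N + N - i) F i j.
  rewrite -(big_nat_widenl i 0 (N + N) xpredT (fun s => F i (s - i)%N)) //.
  rewrite -{1}[i]add0n big_addn.
  by apply: eq_bigr => j _; rewrite addnK.
under eq_bigr => i _ do rewrite colE.
rewrite (@big_cat_nat _ _ _ N) ?leq_addr //= [X in _ + X]big_nat [X in _ + X]big1.
  rewrite addr0 big_mkord; apply: eq_bigr => i _.
  have Ni : (N <= N + N - i)%N by rewrite -addnBA ?leq_addr // ltnW.
  rewrite (@big_cat_nat _ _ _ N) //= big_mkord [X in _ + X]big_nat.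
  rewrite [X in _ + X]big1 ?addr0 // => j /andP[Nj _].
  by rewrite F0 // Nj orbT.
by move=> i /andP[Ni _]; rewrite big1 // => j _; rewrite F0 // Ni.
Qed.

(** The common source of exp(D1 + D2) = exp(D1) exp(D2) and of
    exp(D)(x y) = exp(D) x exp(D) y: for F i j = D1^i D2^j x and T = D1 + D2, or
    F i j = D^i x * D^j y and T = D, the operator T acts on the divided terms
    f i j = F i j / (i! j!) by T f_ij = (i+1) f_(i+1,j) + (j+1) f_(i,j+1).
    Hence T sends the s-th antidiagonal sum to s + 1 times the next one, and by
    induction T^s F_00 / s! is the s-th antidiagonal sum. *)
Lemma exp_leibniz (V : lmodType k) (T : {linear V -> V}) (F : nat -> nat -> V) N :
    (forall i j, T (F i j) = F i.+1 j + F i j.+1) ->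
    (forall i j, (N <= i)%N || (N <= j)%N -> F i j = 0) ->
  \sum_(s < N + N) (s`!%:R)^-1 *: iter s T (F 0 0)%N =
  \sum_(i < N) \sum_(j < N) ((i`!%:R)^-1 * (j`!%:R)^-1) *: F i j.
Proof.
move=> TF F0; pose f i j := ((i`!%:R)^-1 * (j`!%:R)^-1 : k) *: F i j.
have factS i : (i`!%:R)^-1 = i.+1%:R * (i.+1`!%:R)^-1 :> k.
  rewrite factS natrM invfM mulrA mulfV ?mul1r //; exact: natr_succ_neq0.
have Tf i j : T (f i j) = i.+1%:R *: f i.+1 j + j.+1%:R *: f i j.+1.
  rewrite /f linearZ /= TF scalerDr !scalerA; congr (_ *: _ + _ *: _).
    by rewrite factS mulrA.
  by rewrite (factS j) mulrCA.
rewrite -(sum_triangle (F := f)); last by move=> i j /F0; rewrite /f => ->; rewrite scaler0.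
apply: eq_bigr => s _; move: (nat_of_ord s) => {}s.
elim: s => [|s IH]; first by rewrite big_ord1 /f fact0 invr1 mulr1 subnn.
apply: (scalerI (natr_succ_neq0 s)); rewrite scalerA -factS iterS -linearZ IH.
rewrite linear_sum /=; under eq_bigr => i _ do rewrite Tf -subSn ?leq_ord //.
have -> : s.+1%:R *: (\sum_(i < s.+2) f i (s.+1 - i)%N) =
    \sum_(i < s.+2) i%:R *: f i (s.+1 - i)%N +
    \sum_(i < s.+2) (s.+1 - i)%:R *: f i (s.+1 - i)%N.
  rewrite scaler_sumr -big_split /=; apply: eq_bigr => i _.
  by rewrite -scalerDl -natrD subnKC // leq_ord.
rewrite big_split /=; congr (_ + _).
  by rewrite [RHS]big_ord_recl scale0r add0r.
by rewrite [RHS]big_ord_recr /= subnn scale0r addr0.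
Qed.

End Exponential.

Section NilpotentExponential.
Variables (k : fieldType) (V : vectType k).
Hypothesis char0 : [pchar k] =i pred0.
Implicit Types (D : 'End(V)) (x : V).

(** The bound dim V on the order of nilpotency is the one at which the
    truncated exponential stops. *)
Definition nilpotent D := forall x, iter (\dim {:V}) D x = 0.

Lemma iter_comp_lfunE j D x : iter j (comp_lfun D) \1%VF x = iter j D x.
Proof. by elim: j => [|j IH] /=; rewrite ?id_lfunE // comp_lfunE IH. Qed.

Lemma iter_lfun0 j D : iter j D 0 = 0.
Proof. by elim: j => //= j ->; rewrite linear0. Qed.

Lemma nilpotent_iter D j x : nilpotent D -> (\dim {:V} <= j)%N -> iter j D x = 0.
Proof. by move=> D0 /subnK <-; rewrite iterD D0 iter_lfun0. Qed.

(** The truncation order may be increased at will; this removes the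
    dependence on dim V when two exponentials are multiplied or when terms of
    low order are singled out. *)
Lemma nilp_expE D N x : nilpotent D -> (\dim {:V} <= N)%N ->
  nilp_exp D x = \sum_(j < N) (j`!%:R)^-1 *: iter j D x.
Proof.
move=> D0 dN; rewrite /nilp_exp sum_lfunE.
under eq_bigr => j _ do rewrite scale_lfunE iter_comp_lfunE.
rewrite -!(big_mkord xpredT (fun j => (j`!%:R)^-1 *: iter j D x)).
rewrite [RHS](@big_cat_nat _ _ _ (\dim {:V})) //= [X in _ + X]big_nat.
by rewrite [X in _ + X]big1 ?addr0 // => j /andP[dj _]; rewrite nilpotent_iter ?scaler0.
Qed.

Lemma iter_comm D1 D2 i x :
  (forall y, D1 (D2 y) = D2 (D1 y)) -> iter i D1 (D2 x) = D2 (iter i D1 x).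
Proof. by move=> C; elim: i => //= i ->. Qed.

Lemma nilp_expD D1 D2 : nilpotent D1 -> nilpotent D2 -> nilpotent (D1 + D2) ->
    (forall x, D1 (D2 x) = D2 (D1 x)) ->
  nilp_exp (D1 + D2) = (nilp_exp D1 \o nilp_exp D2)%VF.
Proof.
move=> n1 n2 n12 C; apply/lfunP => x; rewrite comp_lfunE.
rewrite (nilp_expE x n12 (leq_addr (\dim {:V}) _)).
rewrite (exp_leibniz char0 (T := (D1 + D2)%R)
  (F := fun i j => iter i D1 (iter j D2 x))) => [|i j|i j].
- rewrite (nilp_expE _ n1 (leqnn _)); apply: eq_bigr => i _.
  rewrite -iter_comp_lfunE (nilp_expE _ n2 (leqnn _)) linear_sum scaler_sumr.
  by apply: eq_bigr => j _; rewrite linearZ /= iter_comp_lfunE scalerA.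
- by rewrite /= add_lfunE -(iter_comm (D1 := D1) (D2 := D2)).
by case/orP => ?; [rewrite nilpotent_iter | rewrite (nilpotent_iter x n2) ?iter_lfun0].
Qed.

Lemma nilpotent0 : nilpotent (0 : 'End(V)).
Proof.
move=> x; case dE: (\dim {:V}) => [|d] /=; last by rewrite zero_lfunE.
by apply/eqP; rewrite -memv0; move/eqP: dE; rewrite dimv_eq0 => /eqP <-; rewrite memvf.
Qed.

Lemma nilp_exp0 : nilp_exp (0 : 'End(V)) = \1%VF.
Proof.
apply/lfunP => x; rewrite (nilp_expE x nilpotent0 (leqnSn _)) big_ord_recl /= big1.
  by rewrite addr0 invr1 scale1r id_lfunE.
by move=> i _; rewrite zero_lfunE scaler0.
Qed.

Lemma nilpotentN D : nilpotent D -> nilpotent (- D).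
Proof.
have iterN j x : iter j (- D) x = (-1) ^+ j *: iter j D x.
  elim: j => [|j IH] /=; first by rewrite scale1r.
  by rewrite IH opp_lfunE linearZ /= exprS -scalerA scaleN1r.
by move=> D0 x; rewrite iterN D0 scaler0.
Qed.

Lemma nilp_expNK D : nilpotent D -> (nilp_exp (- D) \o nilp_exp D = \1)%VF.
Proof.
move=> D0; rewrite -nilp_expD ?addNr ?nilp_exp0 //; [exact: nilpotentN|exact: nilpotent0|].
by move=> x; rewrite !opp_lfunE linearN.
Qed.

Lemma lker0_nilp_exp D : nilpotent D -> lker (nilp_exp D) == 0%VS.
Proof.
move=> D0; apply/lker0P => x y eqxy.
by rewrite -[x]id_lfunE -[y]id_lfunE -(nilp_expNK D0) !comp_lfunE eqxy.
Qed.

Lemma nilp_expV D : nilpotent D -> (nilp_exp D)^-1%VF = nilp_exp (- D).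
Proof.
move=> D0; rewrite -[LHS]comp_lfun1l -(nilp_expNK D0) -comp_lfunA.
by rewrite lker0_compfV ?lker0_nilp_exp // comp_lfun1r.
Qed.

Lemma nilp_exp_conj (h : 'End(V)) D : lker h == 0%VS ->
  (h \o nilp_exp D \o h^-1)%VF = nilp_exp (h \o D \o h^-1)%VF.
Proof.
move=> h0; apply/lfunP => x; rewrite !comp_lfunE /nilp_exp !sum_lfunE linear_sum.
apply: eq_bigr => j _ /=; rewrite !scale_lfunE linearZ /= !iter_comp_lfunE.
congr (_ *: _); elim: (nat_of_ord j) => /= [|{}j <-]; first by rewrite lker0_lfunVK.
by rewrite !comp_lfunE lker0_lfunK.
Qed.

End NilpotentExponential.

Lemma leibniz1 (k : fieldType) (A : falgType k) (D : 'End(A)) :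
  (forall x y, D (x * y) = D x * y + x * D y) -> D 1 = 0.
Proof. by move=> DM; apply: (addrI (D 1)); rewrite addr0 -{3}[1]mulr1 DM mulr1 mul1r. Qed.

Lemma nilp_exp_ahom (k : fieldType) (A : falgType k) (D : 'End(A)) :
    [pchar k] =i pred0 -> nilpotent D ->
    (forall x y, D (x * y) = D x * y + x * D y) ->
  ahom_in {:A} (nilp_exp D).
Proof.
move=> char0 D0 DM; have D1 := leibniz1 DM.
apply/ahom_inP; split=> [x y _ _|].
  rewrite (nilp_expE _ D0 (leq_addr (\dim {:A}) _)).
  rewrite (exp_leibniz char0 (F := fun i j => iter i D x * iter j D y)) => [|i j|i j].
  - rewrite !(nilp_expE _ D0 (leqnn _)) mulr_suml; apply: eq_bigr => i _.
    by rewrite mulr_sumr; apply: eq_bigr => j _; rewrite -scalerAl -scalerAr scalerA.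
  - exact: DM.
  by case/orP => ?; [rewrite (nilpotent_iter x D0) ?mul0r | rewrite (nilpotent_iter y D0) ?mulr0].
rewrite (nilp_expE _ D0 (leqnSn _)) big_ord_recl /= big1 ?addr0 ?invr1 ?scale1r //.
by move=> i _; rewrite -iterS iterSr D1 iter_lfun0 scaler0.
Qed.

(** * Polynomial and regular functions on matrices *)

Section PolynomialFunctions.
Variables (k : fieldType) (N : nat) (X : Type) (x : X -> 'I_N -> k).
Implicit Types (c : X -> k).

(** X is a set with coordinate functions x; the same notion serves for
    'End(V) with its matrix entries and for k^r with its standard coordinates. *)
Definition polyfun c := exists P : {mpoly k[N]}, forall a, c a = P.@[x a].

Lemma polyfun_ext c c' : c =1 c' -> polyfun c -> polyfun c'.
Proof. by move=> cc' [P cP]; exists P => a; rewrite -cc'. Qed.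

Lemma polyfun_const (b : k) : polyfun (fun=> b).
Proof. by exists b%:MP => a; rewrite mevalC. Qed.

Lemma polyfun_coord i : polyfun (fun a => x a i).
Proof. by exists 'X_i => a; rewrite mevalXU. Qed.

Lemma polyfunD c c' : polyfun c -> polyfun c' -> polyfun (fun a => c a + c' a).
Proof. by move=> [P cP] [Q cQ]; exists (P + Q) => a; rewrite mevalD cP cQ. Qed.

Lemma polyfunM c c' : polyfun c -> polyfun c' -> polyfun (fun a => c a * c' a).
Proof. by move=> [P cP] [Q cQ]; exists (P * Q) => a; rewrite mevalM cP cQ. Qed.

Lemma polyfunB c c' : polyfun c -> polyfun c' -> polyfun (fun a => c a - c' a).
Proof. by move=> [P cP] [Q cQ]; exists (P - Q) => a; rewrite mevalB cP cQ. Qed.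

Lemma polyfun_sum I (r : seq I) (c : I -> X -> k) :
  (forall i, polyfun (c i)) -> polyfun (fun a => \sum_(i <- r) c i a).
Proof.
move=> cP; elim: r => [|i r IH].
  by apply: polyfun_ext (polyfun_const 0) => a; rewrite big_nil.
by apply: polyfun_ext (polyfunD (cP i) IH) => a; rewrite big_cons.
Qed.

Lemma polyfun_prod I (r : seq I) (c : I -> X -> k) :
  (forall i, polyfun (c i)) -> polyfun (fun a => \prod_(i <- r) c i a).
Proof.
move=> cP; elim: r => [|i r IH].
  by apply: polyfun_ext (polyfun_const 1) => a; rewrite big_nil.
by apply: polyfun_ext (polyfunM (cP i) IH) => a; rewrite big_cons.
Qed.

Lemma polyfun_det m (M : X -> 'M[k]_m) :
  (forall i j, polyfun (fun a => M a i j)) -> polyfun (fun a => \det (M a)).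
Proof.
move=> MP; apply: polyfun_sum => s.
by apply: polyfunM; [exact: polyfun_const | apply: polyfun_prod => i].
Qed.

Variable V : vectType k.

Definition polymap (F : X -> 'End(V)) :=
  forall i, polyfun (fun a => End_coord (F a) i).

Lemma End_coordE (f : 'End(V)) i j : End_coord f (mxvec_index i j) = End_mx f i j.
Proof. exact: mxvecE. Qed.

Lemma End_coord_inj (f g : 'End(V)) : (forall i, End_coord f i = End_coord g i) -> f = g.
Proof.
move=> fg; apply: (can_inj (mxofK (vbasisP {:V}) (vbasisP {:V}))).
by apply/matrixP => i j; have := fg (mxvec_index i j); rewrite !End_coordE.
Qed.

Lemma polymapP F : polymap F <-> forall i j, polyfun (fun a => End_mx (F a) i j).
Proof.
split=> [FP i j | FP l].
  by apply: polyfun_ext (FP (mxvec_index i j)) => a; rewrite End_coordE.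
case/mxvec_indexP: l => i j.
by apply: polyfun_ext (FP i j) => a; rewrite End_coordE.
Qed.

Lemma polymap_ext F F' : F =1 F' -> polymap F -> polymap F'.
Proof. by move=> FF' FP i; apply: polyfun_ext (FP i) => a; rewrite FF'. Qed.

Lemma polymap_const f : polymap (fun=> f).
Proof. by move=> i; apply: polyfun_const. Qed.

Lemma End_coordP (b : k) (f g : 'End(V)) i :
  End_coord (b *: f + g) i = b * End_coord f i + End_coord g i.
Proof. by case/mxvec_indexP: i => i j; rewrite !End_coordE /End_mx linearP !mxE. Qed.

Lemma polymapD F G : polymap F -> polymap G -> polymap (fun a => F a + G a).
Proof.
move=> FP GP i; apply: polyfun_ext (polyfunD (FP i) (GP i)) => a.
by rewrite -[F a in RHS]scale1r End_coordP mul1r.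
Qed.

Lemma polymapZ c F : polyfun c -> polymap F -> polymap (fun a => c a *: F a).
Proof.
move=> cP FP i; apply: polyfun_ext (polyfunM cP (FP i)) => a.
case/mxvec_indexP: i => i j.
by rewrite !End_coordE /End_mx linearZ [RHS]mxE.
Qed.

Lemma polymap_sum I (r : seq I) (F : I -> X -> 'End(V)) :
  (forall i, polymap (F i)) -> polymap (fun a => \sum_(i <- r) F i a).
Proof.
move=> FP; elim: r => [|i r IH].
  by apply: polymap_ext (polymap_const 0) => a; rewrite big_nil.
by apply: polymap_ext (polymapD (FP i) IH) => a; rewrite big_cons.
Qed.

Lemma polymap_comp F G : polymap F -> polymap G -> polymap (fun a => (F a \o G a)%VF).
Proof.
move=> /polymapP FP /polymapP GP; apply/polymapP => i j.
apply: (@polyfun_ext (fun a => \sum_l End_mx (G a) i l * End_mx (F a) l j)).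
  by move=> a; rewrite /End_mx (mxof_comp _ _ (vbasisP _)) mxE.
by apply: polyfun_sum => l; apply: polyfunM.
Qed.

(** The truncated exponential is a fixed polynomial in its argument. *)
Lemma polymap_nilp_exp F : polymap F -> polymap (fun a => nilp_exp (F a)).
Proof.
move=> FP; apply: polymap_sum => j; apply: polymapZ; first exact: polyfun_const.
by elim: (nat_of_ord j) => [|{}j IH] /=; [exact: polymap_const | exact: polymap_comp].
Qed.

End PolynomialFunctions.

Section RegularFunctions.
Variables (k : fieldType) (V : vectType k).
Implicit Types (U : 'End(V) -> Prop) (c : 'End(V) -> k) (l : {scalar 'End(V)}).

(** The matrix units for the basis that defines the affine coordinates. *)
Definition End_unit (i j : 'I_(\dim {:V})) : 'End(V) :=
  hommx (vbasis {:V}) (vbasis {:V}) (delta_mx i j).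

Lemma scalar_EndE l f :
  l f = \sum_(u : 'I_(\dim {:V}) * 'I_(\dim {:V})) End_mx f u.1 u.2 * l (End_unit u.1 u.2).
Proof.
rewrite -{1}(mxofK (vbasisP {:V}) (vbasisP {:V}) f) -/(End_mx f).
rewrite [End_mx f in LHS]matrix_sum_delta pair_big /= !linear_sum.
by apply: eq_bigr => u _; rewrite !linearZ.
Qed.

Lemma polyfun_scalar l : polyfun (@End_coord k V) l.
Proof.
apply: (polyfun_ext (fun f => esym (scalar_EndE l f))); apply: polyfun_sum => u.
apply: polyfunM; last exact: polyfun_const.
by apply: polyfun_ext (polyfun_coord _ (mxvec_index u.1 u.2)) => f; rewrite End_coordE.
Qed.

Lemma regular_polyfun U c : polyfun (@End_coord k V) c -> regular_on U c.
Proof. by case=> P cP; exists P, 0%N => f _; rewrite expr0 divr1 cP. Qed.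

Lemma regularM U c c' : regular_on U c -> regular_on U c' ->
  regular_on U (fun f => c f * c' f).
Proof.
move=> [P [r cP]] [Q [s cQ]]; exists (P * Q), (r + s)%N => f Uf.
by rewrite cP // cQ // mevalM exprD invfM mulrACA.
Qed.

Lemma regular_prod U I (r : seq I) (c : I -> 'End(V) -> k) :
  (forall i, regular_on U (c i)) -> regular_on U (fun f => \prod_(i <- r) c i f).
Proof.
move=> cP; elim: r => [|i r IH].
  by exists 1, 0%N => f _; rewrite big_nil meval1 expr0 divr1.
have [P [s PE]] := regularM (cP i) IH.
by exists P, s => f Uf; rewrite big_cons PE.
Qed.

Lemma regularX U c m : regular_on U c -> regular_on U (fun f => c f ^+ m).
Proof.
move=> cP; have [P [s PE]] := regular_prod (index_iota 0 m) (fun=> cP).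
by exists P, s => f Uf; rewrite -PE // prodr_const_nat subn0.
Qed.

(** Cramer's rule, which puts the entries of the inverse in k[entries, 1/det]. *)
Lemma End_mx_inv (f : 'End(V)) : lker f == 0%VS ->
  End_mx (f^-1)%VF = (\det (End_mx f))^-1 *: \adj (End_mx f).
Proof.
move=> f0; have ff : End_mx f *m End_mx (f^-1)%VF = 1%:M.
  rewrite /End_mx -(mxof_comp _ _ (vbasisP _)) lker0_compVf //.
  by rewrite mxof1 // (basis_free (vbasisP _)).
have [uf _] := mulmx1_unit ff.
by rewrite -[LHS](mulKmx uf) ff mulmx1 /invmx uf.
Qed.

Lemma regular_scalar_inv U l : (forall f, U f -> lker f == 0%VS) ->
  regular_on U (fun f => l (f^-1)%VF).
Proof.
move=> U0.
have [P PE] : polyfun (@End_coord k V) (fun f =>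
    \sum_(u : 'I_(\dim {:V}) * 'I_(\dim {:V}))
      (\adj (End_mx f)) u.1 u.2 * l (End_unit u.1 u.2)).
  apply: polyfun_sum => u; apply: polyfunM; last exact: polyfun_const.
  apply: (@polyfun_ext _ _ _ _ (fun f => cofactor (End_mx f) u.2 u.1)) => [f|].
    by rewrite mxE.
  apply: polyfunM; first exact: polyfun_const.
  apply: polyfun_det => i j.
  apply: polyfun_ext (polyfun_coord _ (mxvec_index (lift u.2 i) (lift u.1 j))) => f.
  by rewrite End_coordE !mxE.
exists P, 1%N => f /U0 f0; rewrite -PE expr1 scalar_EndE End_mx_inv // mulr_suml.
by apply: eq_bigr => u _; rewrite mxE mulrC mulrA mulrC -!mulrA.
Qed.

End RegularFunctions.

(** * Degrees and monomials of the quotient algebra *)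

Section Degrees.
Variables (k : fieldType) (n : nat).
Local Notation M := {ffun 'I_n -> int}.
Implicit Types (a b : M) (m : 'X_{1..n}) (p : 'rV[k]_n).

Lemma innerP b : reflect (forall i, 0 <= b i) (inner b).
Proof. exact: forallP. Qed.

Lemma inner_mnm m : inner (mnm_deg m).
Proof. by apply/innerP => i; rewrite ffunE. Qed.

Lemma innerD a b : inner a -> inner b -> inner (a + b).
Proof.
by move=> /innerP a0 /innerP b0; apply/innerP => i; rewrite ffunE addr_ge0.
Qed.

Lemma mnm_degK : cancel (@mnm_deg n) (@deg_mnm n).
Proof. by move=> m; apply/mnmP => i; rewrite mnmE ffunE. Qed.

Lemma deg_mnmK b : inner b -> mnm_deg (deg_mnm b) = b.
Proof. by move/innerP => b0; apply/ffunP => i; rewrite ffunE mnmE gez0_abs. Qed.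

Lemma mnm_degD m m' : mnm_deg (m + m')%MM = mnm_deg m + mnm_deg m'.
Proof. by apply/ffunP => i; rewrite !ffunE mnmDE PoszD. Qed.

Lemma mnm_deg0 : mnm_deg (0 : 'X_{1..n})%MM = 0.
Proof. by apply/ffunP => i; rewrite !ffunE mnm0E. Qed.

Lemma mnm_deg1 (i : 'I_n) : mnm_deg U_(i)%MM = e_ i.
Proof. by apply/ffunP => j; rewrite !ffunE mnm1E eq_sym. Qed.

Lemma inner_e (i : 'I_n) : inner (e_ i).
Proof. by rewrite -mnm_deg1 inner_mnm. Qed.

Lemma deg_neq0P a : a != 0 -> exists i, a i != 0.
Proof.
move=> a0; apply/existsP; apply: contraNT a0; rewrite negb_exists => /forallP a0.
by apply/eqP/ffunP => i; rewrite ffunE; apply/eqP; rewrite -[_ == _]negbK.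
Qed.

Lemma degMn_inj a : a != 0 -> injective (fun j => a *+ j).
Proof.
move=> a0 j j' /ffunP ajj'.
have [i ai] := deg_neq0P a0.
by have := ajj' i; rewrite !ffunMnE => /(mulrIn ai).
Qed.

Lemma Xdeg_mnm m : Xdeg k (mnm_deg m) = 'X_[m].
Proof. by rewrite /Xdeg inner_mnm mnm_degK. Qed.

Lemma XdegD a b : inner a -> inner b -> Xdeg k (a + b) = Xdeg k a * Xdeg k b.
Proof.
move=> a0 b0; rewrite -(deg_mnmK a0) -(deg_mnmK b0) -mnm_degD !Xdeg_mnm.
exact: mpolyXD.
Qed.

Lemma N_pair_degD p a b : N_pair p (a + b) = N_pair p a + N_pair p b.
Proof. by rewrite /N_pair -big_split; apply: eq_bigr => i _; rewrite ffunE mulrzDr. Qed.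

Lemma N_pairP c p q b : N_pair (c *: p + q) b = c * N_pair p b + N_pair q b.
Proof.
rewrite /N_pair mulr_sumr -big_split; apply: eq_bigr => i _ /=.
by rewrite !mxE mulrzDl -mulrzAr.
Qed.

Lemma N_pair0 b : N_pair (0 : 'rV[k]_n) b = 0.
Proof. by rewrite /N_pair big1 // => i _; rewrite mxE mul0rz. Qed.

Lemma N_pair_e p i : N_pair p (e_ i) = p 0 i.
Proof.
rewrite /N_pair (bigD1 i) //= ffunE eqxx mulr1z big1 ?addr0 // => j ji.
by rewrite ffunE (negbTE ji) mulr0z.
Qed.

End Degrees.

Section MonomialBasis.
Variables (k : fieldType) (n : nat) (I : cofMonIdeal k n).
Local Notation A := (mquot I).
Local Notation M := {ffun 'I_n -> int}.
Implicit Types (a b : M) (m : 'X_{1..n}) (x y : A).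

(** The image of x^b, which is zero when b has a negative coordinate. *)
Definition xbar b : A := mproj I (Xdeg k b).

(** The degrees outside supp(I): those of the monomial basis of A. *)
Definition basis_degree b := inner b && (deg_mnm b \notin isupp I).

Lemma basis_degree_mnm m : basis_degree (mnm_deg m) = (m \notin isupp I).
Proof. by rewrite /basis_degree inner_mnm mnm_degK. Qed.

Lemma xbar_out b : ~~ inner b -> xbar b = 0.
Proof. by rewrite /xbar /Xdeg => /negbTE ->; rewrite raddf0. Qed.

Lemma mproj_eq0 q : (mproj I q == 0) = (q \in (I : {pred _})).
Proof. by rewrite -(raddf0 (mproj I)) mproj_eq subr0. Qed.

Lemma xbar_eq0 b : (xbar b == 0) = ~~ basis_degree b.
Proof.
rewrite /basis_degree; case b0: (inner b) => /=; last by rewrite xbar_out ?b0 ?eqxx.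
by rewrite /xbar -(deg_mnmK b0) Xdeg_mnm mnm_degK mproj_eq0 negbK.
Qed.

Lemma xbarD a b : inner a -> inner b -> xbar (a + b) = xbar a * xbar b.
Proof. by move=> a0 b0; rewrite /xbar XdegD // rmorphM. Qed.

Lemma xbar_mnm m : xbar (mnm_deg m) = mproj I 'X_[m].
Proof. by rewrite /xbar Xdeg_mnm. Qed.

(** A is spanned by the images of the monomials. *)
Lemma mquot_ind (P : A -> Prop) :
    P 0 -> (forall c x y, P x -> P y -> P (c *: x + y)) ->
    (forall m, P (xbar (mnm_deg m))) ->
  forall x, P x.
Proof.
move=> P0 PD Pm x; rewrite -(mreprK x) [mrepr x]mpolyE raddf_sum.
elim: (msupp _) => [|m r IH]; first by rewrite big_nil.
by rewrite big_cons /= linearZ /= -xbar_mnm; apply: PD.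
Qed.

Lemma xbar_ext (V : vectType k) (f g : 'Hom(A, V)) :
  (forall m, f (xbar (mnm_deg m)) = g (xbar (mnm_deg m))) -> f = g.
Proof.
move=> fg; apply/lfunP; apply: mquot_ind => [|c x y fx fy|//].
  by rewrite !linear0.
by rewrite !linearP /= fx fy.
Qed.

Lemma coef_mrepr q m : m \notin isupp I -> (mrepr (mproj I q))@_m = q@_m.
Proof.
move=> mI; apply/eqP; rewrite -subr_eq0 -mcoeffB; apply: contraNT mI => c0.
apply: (@ideal_coefP _ _ I (mrepr (mproj I q) - q)); last by rewrite mcoeff_msupp.
by rewrite -mproj_eq mreprK.
Qed.

(** The linear form dual to the monomial of degree b; it is extended by zero to
    the degrees without a basis monomial, so that it is linear for every b. *)
Definition bcoef b x : k := if basis_degree b then (mrepr x)@_(deg_mnm b) else 0.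

Fact bcoef_is_scalar b : scalar (bcoef b).
Proof.
move=> c x y; rewrite /bcoef; case: ifP => [/andP[_ bI]|_]; last by rewrite mulr0 addr0.
rewrite -[x in LHS]mreprK -[y in LHS]mreprK -linearP coef_mrepr //.
by rewrite mcoeffD mcoeffZ.
Qed.
HB.instance Definition _ b :=
  GRing.isLinear.Build k A k _ (bcoef b) (bcoef_is_scalar b).

Lemma bcoef_xbar b b' : bcoef b (xbar b') = (basis_degree b && (b == b'))%:R.
Proof.
rewrite /bcoef; case: ifP => //= bb; have /andP[b0 bI] := bb.
rewrite coef_mrepr // /Xdeg; case: ifPn => [b0'|nb'].
  rewrite mcoeffX; congr (_%:R); congr nat_of_bool.
  apply/eqP/eqP => [/(congr1 (@mnm_deg n))|->//].
  by rewrite !deg_mnmK.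
by rewrite mcoeff0; case: eqP => // bE; rewrite -bE b0 in nb'.
Qed.

Lemma dim_mquot : \dim {:A} = size (cmi_basis I).
Proof. by rewrite dimvf. Qed.

(** This is homogeneity of degree a, in a form that can be iterated. *)
Definition shifts a (D : 'End(A)) :=
  forall b, exists c, D (xbar b) = c *: xbar (b + a).

Lemma homogeneous_shifts a D : homogeneous a D -> shifts a D.
Proof.
move=> hD b; apply/vlineP; apply: (subvP (hD b)).
exact/memv_img/memv_line.
Qed.

Lemma shifts_iter a D b j : shifts a D ->
  exists c, iter j D (xbar b) = c *: xbar (b + a *+ j).
Proof.
move=> hD; elim: j => [|j [c IH]]; first by exists 1; rewrite mulr0n addr0 scale1r.
have [c' hc'] := hD (b + a *+ j).
by exists (c * c'); rewrite iterS IH linearZ /= hc' scalerA -addrA -mulrSr.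
Qed.

(** If D^d x^b were nonzero for d = dim A, then b, b + a, ..., b + d a would be
    d + 1 distinct degrees of basis monomials. *)
Lemma shifts_nilpotent a D : a != 0 -> shifts a D -> nilpotent D.
Proof.
move=> a0 hD x; rewrite -iter_comp_lfunE.
suff -> : iter (\dim {:A}) (comp_lfun D) \1%VF = 0 by rewrite zero_lfunE.
apply: xbar_ext => m; rewrite zero_lfunE iter_comp_lfunE.
set b := mnm_deg m; apply/eqP; apply: contraT => Dn0.
have nz j : (j <= \dim {:A})%N -> basis_degree (b + a *+ j).
  move=> jd; rewrite -[basis_degree _]negbK -xbar_eq0; apply: contra Dn0 => /eqP xb0.
  have [c hc] := shifts_iter b j hD.
  by rewrite -(subnK jd) iterD hc xb0 scaler0 iter_lfun0.
pose s := [seq deg_mnm (b + a *+ j) | j <- iota 0 (\dim {:A}).+1].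
(* the degrees b + j a are distinct because a is nonzero *)
have us : uniq s.
  rewrite map_inj_in_uniq ?iota_uniq // => i j; rewrite !mem_iota !ltnS /= => ii ji.
  move/(congr1 (@mnm_deg n)); rewrite !deg_mnmK; try by case/andP: (nz _ ii).
    by move/addrI; apply: degMn_inj.
  by case/andP: (nz _ ji).
have /(uniq_leq_size us) : {subset s <= cmi_basis I}.
  move=> _ /mapP[j + ->]; rewrite mem_iota ltnS /= mem_cmi_basis => jd.
  by case/andP: (nz _ jd).
by rewrite -dim_mquot size_map size_iota ltnn.
Qed.

Lemma bcoef_iter a D b b' j : shifts a D -> b' != b + a *+ j ->
  bcoef b' (iter j D (xbar b)) = 0.
Proof.
move=> hD bb'; have [c ->] := shifts_iter b j hD.
by rewrite linearZ /= bcoef_xbar (negbTE bb') andbF mulr0.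
Qed.

End MonomialBasis.

(** * The homogeneous derivations *)

Section HomogeneousDerivations.
Variables (k : fieldType) (n : nat) (I : cofMonIdeal k n).
Local Notation A := (mquot I).
Local Notation M := {ffun 'I_n -> int}.
Implicit Types (a b : M) (m : 'X_{1..n}) (p q : 'rV[k]_n).

(** Enlarging the range of summation beyond the support puts f, g and c f + g over
    the same range, which is what linearity requires. *)
Lemma hder_widen a p (f : {mpoly k[n]}) (s : seq 'X_{1..n}) :
    uniq s -> {subset msupp f <= s} ->
  hder a p f = \sum_(m <- s) (f@_m * N_pair p (mnm_deg m)) *: Xdeg k (mnm_deg m + a).
Proof.
move=> us fs; rewrite /hder -[RHS](@big_rmcond _ _ _ _ _ (fun m => m \in msupp f)) => [|m]; last first.
  by move/memN_msupp_eq0 => ->; rewrite mul0r scale0r.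
rewrite -[RHS]big_filter; apply: perm_big; apply: uniq_perm => [||m].
- exact: msupp_uniq.
- exact: filter_uniq.
by rewrite mem_filter; case mf: (m \in msupp f) => //=; rewrite fs.
Qed.

Lemma hder_linear a p : linear (hder a p).
Proof.
move=> c f g; set s := undup (msupp f ++ msupp g).
have us : uniq s by exact: undup_uniq.
rewrite (hder_widen a p us) => [|m]; last first.
  rewrite mem_undup mem_cat => /msuppD_le; rewrite mem_cat => /orP[/msuppZ_le->//|->].
  by rewrite orbT.
rewrite (hder_widen a p (f := f) us) => [|m mf]; last by rewrite mem_undup mem_cat mf.
rewrite (hder_widen a p (f := g) us) => [|m mg]; last by rewrite mem_undup mem_cat mg orbT.
rewrite scaler_sumr -big_split; apply: eq_bigr => m _ /=.
by rewrite mcoeffD mcoeffZ scalerA -scalerDl mulrDl !mulrA.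
Qed.

Lemma hder_X a p m :
  hder a p 'X_[m] = N_pair p (mnm_deg m) *: Xdeg k (mnm_deg m + a).
Proof. by rewrite /hder msuppX big_seq1 mcoeffX eqxx mul1r. Qed.

(** This is what makes the derivation of degree a attached to p well defined on A:
    p kills the exponents m that a moves out of the positive orthant, and the
    derivation maps monomials of I to I. *)
Definition admissible a p := forall m, N_pair p (mnm_deg m) != 0 ->
  inner (mnm_deg m + a) /\ (m \in isupp I -> xbar I (mnm_deg m + a) = 0).

Section Admissible.
Variables (a : M) (p : 'rV[k]_n).
Hypothesis adm : admissible a p.

Lemma hder_preserves (f : {mpoly k[n]}) :
  f \in (I : {pred {mpoly k[n]}}) -> mproj I (hder a p f) = 0.
Proof.
move=> /ideal_coefP fI; rewrite /hder raddf_sum big_seq big1 //= => m /fI mI.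
rewrite linearZ /= -/(xbar I _); have [->|/adm[_ ->//]] := eqVneq (N_pair p (mnm_deg m)) 0.
  by rewrite mulr0 scale0r.
by rewrite scaler0.
Qed.

Lemma hder_quot_linear : linear (fun x : A => mproj I (hder a p (mrepr x))).
Proof.
move=> c x y; rewrite -linearP -hder_linear; apply/eqP.
rewrite -subr_eq0 -raddfB /= -[X in _ + X]scaleN1r addrC -hder_linear.
rewrite hder_preserves // scaleN1r addrC -mproj_eq mreprK linearP /=.
by rewrite !mreprK.
Qed.

(** The derivation preserves I, so its value on a class can be read off from any
    representative, and not only from the one chosen by [mrepr]. *)
Lemma hder_quotE (f : {mpoly k[n]}) : hder_quot I a p (mproj I f) = mproj I (hder a p f).
Proof.
pose h : {linear A -> A} := HB.pack (fun x : A => mproj I (hder a p (mrepr x)))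
  (GRing.isLinear.Build k A A _ _ hder_quot_linear).
rewrite /hder_quot (lfunE h) /=; apply/eqP.
rewrite -subr_eq0 -raddfB /= -[X in _ + X]scaleN1r addrC -hder_linear.
by rewrite hder_preserves // scaleN1r addrC -mproj_eq mreprK.
Qed.

Lemma hder_quot_xbar b : inner b ->
  hder_quot I a p (xbar I b) = N_pair p b *: xbar I (b + a).
Proof.
move=> b0; rewrite -(deg_mnmK b0) xbar_mnm hder_quotE hder_X linearZ.
by [].
Qed.

Lemma hder_quot_shifts : shifts a (hder_quot I a p).
Proof.
move=> b; have [b0|b0] := boolP (inner b).
  by exists (N_pair p b); rewrite hder_quot_xbar.
by exists 0; rewrite xbar_out // linear0 scale0r.
Qed.

Lemma admissible_out b : inner b -> ~~ inner (b + a) -> N_pair p b = 0.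
Proof.
move=> b0 ba; apply/eqP; apply: contraNT ba => pb.
by rewrite -(deg_mnmK b0); case: (@adm (deg_mnm b)); rewrite ?deg_mnmK.
Qed.

(** By bilinearity it is enough to look at two monomials, where the rule is the
    additivity of p: p(m + m') = p(m) + p(m'). *)
Lemma hder_quot_derivation : derivation (hder_quot I a p).
Proof.
set D := hder_quot I a p.
apply: mquot_ind => [y|c x y IHx IHy z|m].
- by rewrite mul0r linear0 !mul0r add0r.
- rewrite mulrDl -scalerAl !linearP /= IHx IHy.
  by rewrite !mulrDl -!scalerAl scalerDr addrACA.
apply: mquot_ind => [|c x y IHx IHy|m'].
- by rewrite mulr0 linear0 !mulr0 addr0.
- rewrite mulrDr -scalerAr !linearP /= IHx IHy.
  by rewrite !mulrDr -!scalerAr scalerDr addrACA.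
have m0 := inner_mnm m; have m0' := inner_mnm m'.
(* one of the two terms of the Leibniz rule; the other one is its mirror image *)
have half b b' : inner b -> inner b' ->
    N_pair p b *: xbar I (b + b' + a) = D (xbar I b) * xbar I b'.
  move=> b0 b0'; rewrite hder_quot_xbar //.
  have [ba|ba] := boolP (inner (b + a)); last by rewrite admissible_out // !scale0r mul0r.
  by rewrite -scalerAl -xbarD // addrAC.
rewrite -xbarD // hder_quot_xbar ?innerD // N_pair_degD scalerDl half //.
by rewrite [mnm_deg m + _]addrC half // [X in _ + X = _]mulrC.
Qed.

End Admissible.

Lemma hder_quotP a c p q : admissible a p -> admissible a q ->
  admissible a (c *: p + q) ->
  hder_quot I a (c *: p + q) = c *: hder_quot I a p + hder_quot I a q.
Proof.
move=> ap aq apq; apply: xbar_ext => m.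
rewrite add_lfunE scale_lfunE !hder_quot_xbar ?inner_mnm // N_pairP.
by rewrite scalerDl scalerA.
Qed.

(** Multiplication by x^a preserves both the polynomial ring and the ideal. *)
Lemma admissible_inner a p : inner a -> admissible a p.
Proof.
move=> a0 m _; split; first by rewrite innerD ?inner_mnm.
move=> mI; rewrite xbarD ?inner_mnm //.
have /eqP -> : xbar I (mnm_deg m) == 0 by rewrite xbar_eq0 basis_degree_mnm negbK.
by rewrite mul0r.
Qed.

End HomogeneousDerivations.

(** * Coefficients of products of exponentials *)

Section ExponentialCoefficients.
Variables (k : fieldType) (n : nat) (I : cofMonIdeal k n).
Local Notation M := {ffun 'I_n -> int}.
Variable a : M.
Hypothesis a_neq0 : a != 0.
Implicit Types (b : M) (D : 'End(mquot I)).

(** As a is nonzero, among the degrees b + j a only j = s gives b + s a. *)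
Lemma bcoef_nilp_exp D b s : shifts a D ->
  bcoef (b + a *+ s) (nilp_exp D (xbar I b)) =
  (s`!%:R)^-1 * bcoef (b + a *+ s) (iter s D (xbar I b)).
Proof.
move=> hD; have Dn := shifts_nilpotent a_neq0 hD.
rewrite (nilp_expE _ Dn (leq_addr s.+1 _)) linear_sum.
have sN : (s < \dim {:mquot I} + s.+1)%N by rewrite addnS ltnS leq_addl.
rewrite (bigD1 (Ordinal sN)) //= linearZ big1 ?addr0 //= => j js.
rewrite linearZ /= (bcoef_iter hD) ?mulr0 //; apply: contra js => /eqP/addrI/(degMn_inj a_neq0) sj.
by apply/eqP/val_inj/esym.
Qed.

Lemma bcoef_nilp_exp0 D b b' : shifts a D -> (forall j, b' != b + a *+ j) ->
  bcoef b' (nilp_exp D (xbar I b)) = 0.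
Proof.
move=> hD bb'; have Dn := shifts_nilpotent a_neq0 hD.
rewrite (nilp_expE _ Dn (leqnn _)) linear_sum big1 // => j _.
by rewrite linearZ /= (bcoef_iter hD) ?mulr0.
Qed.

(** The coefficient in degree b + s a only sees the terms D1^j D2^l with
    j + l = s. *)
Lemma bcoef_nilp_exp_comp D1 D2 b s : shifts a D1 -> shifts a D2 ->
  bcoef (b + a *+ s) (nilp_exp D1 (nilp_exp D2 (xbar I b))) =
  \sum_(l < s.+1) (l`!%:R)^-1 * ((s - l)`!%:R)^-1 *
     bcoef (b + a *+ s) (iter (s - l)%N D1 (iter l D2 (xbar I b))).
Proof.
move=> hD1 hD2; have D2n := shifts_nilpotent a_neq0 hD2.
have termE l : exists c, forall r, bcoef (b + a *+ r) (nilp_exp D1 (iter l D2 (xbar I b))) =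
    c * bcoef (b + a *+ r) (nilp_exp D1 (xbar I (b + a *+ l))).
  by have [c ->] := shifts_iter b l hD2; exists c => r; rewrite !linearZ.
(* the terms with l > s are in degrees b + l a + j a, never equal to b + s a *)
rewrite (nilp_expE _ D2n (leq_addl s.+1 _)) !linear_sum big_split_ord /=.
rewrite [X in _ + X]big1 ?addr0 => [|j _]; last first.
  rewrite !linearZ /=; have [c ->] := termE (s.+1 + j)%N.
  rewrite bcoef_nilp_exp0 ?mulr0 // => r; rewrite -addrA -mulrnDr.
  apply/eqP => /addrI/(degMn_inj a_neq0) sE.
  by have := leq_addr (j + r) s.+1; rewrite addnA -sE ltnn.
apply: eq_bigr => l _; rewrite !linearZ /= -mulrA; congr (_ * _).
have [c hc] := shifts_iter b l hD2; have ls := leq_ord l.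
rewrite hc !linearZ /= -{1}(subnKC ls) mulrnDr addrA bcoef_nilp_exp //.
rewrite mulrCA; congr (_ * _); rewrite -addrA -mulrnDr subnKC //.
by rewrite -!iter_comp_lfunE !linearZ.
Qed.

End ExponentialCoefficients.

(** * The torus and its characters *)

Section Torus.
Variables (k : fieldType) (n : nat) (I : cofMonIdeal k n).
Hypothesis XnotinI : forall i : 'I_n, 'X_i \notin (I : {pred {mpoly k[n]}}).
Local Notation A := (mquot I).
Local Notation M := {ffun 'I_n -> int}.
Local Notation T := (max_torus I).
Implicit Types (a b : M) (m : 'X_{1..n}) (p : 'rV[k]_n) (h : 'End(A)).

(** A linear form in the entries of h, hence a polynomial function. *)
Definition matrix_coef b (x : A) h := bcoef b (h x).

Fact matrix_coef_is_scalar b x : scalar (matrix_coef b x).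
Proof. by move=> c f g; rewrite /matrix_coef add_lfunE scale_lfunE linearP. Qed.
HB.instance Definition _ b x :=
  GRing.isLinear.Build k 'End(A) k _ (matrix_coef b x) (matrix_coef_is_scalar b x).

(** On the torus this is the eigenvalue t_i of h on x_i. *)
Definition tcoord (i : 'I_n) : 'End(A) -> k := matrix_coef (e_ i) (xbar I (e_ i)).

(** The character t^b of the torus, given by a formula that makes sense on all
    of 'End(A). *)
Definition tchar b h := \prod_i tcoord i h ^ b i.

Lemma xbar_e i : xbar I (e_ i) = mproj I 'X_i.
Proof. by rewrite -mnm_deg1 xbar_mnm. Qed.

Lemma basis_degree_e i : basis_degree I (e_ i).
Proof. by rewrite -mnm_deg1 basis_degree_mnm inE XnotinI. Qed.

Lemma torus_xbar_e h i : T h ->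
  tcoord i h != 0 /\ h (xbar I (e_ i)) = tcoord i h *: xbar I (e_ i).
Proof.
case=> _ [t /(_ i)[ti0 hi]]; rewrite -xbar_e in hi.
suff -> : tcoord i h = t i by [].
by rewrite /tcoord /matrix_coef hi linearZ /= bcoef_xbar eqxx basis_degree_e mulr1.
Qed.

Lemma tcoord_neq0 h i : T h -> tcoord i h != 0.
Proof. by case/(torus_xbar_e i). Qed.

Lemma tchar_neq0 h b : T h -> tchar b h != 0.
Proof. by move=> Th; apply/prodf_neq0 => i _; rewrite expfz_neq0 ?tcoord_neq0. Qed.

Lemma tcharD h b b' : T h -> tchar (b + b') h = tchar b h * tchar b' h.
Proof.
move=> Th; rewrite /tchar -big_split; apply: eq_bigr => i _ /=.
by rewrite ffunE expfzDr ?tcoord_neq0.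
Qed.

(** Torus elements are algebra morphisms, so the eigenvalue on x^b is the product
    of those on the variables. *)
Lemma torus_xbar h b : T h -> inner b -> h (xbar I b) = tchar b h *: xbar I b.
Proof.
move=> Th b0; rewrite -(deg_mnmK b0) xbar_mnm mpolyXE_id rmorph_prod.
have [[_ hM] _] := Th.
rewrite -[LHS]/(ahval (AHom hM) _) !rmorph_prod /= /tchar -scaler_prod.
apply: eq_bigr => i _; have [_ hi] := torus_xbar_e i Th.
rewrite rmorphXn /= -xbar_e -[LHS]/(ahval (AHom hM) _) rmorphXn /= hi.
by rewrite exprZn ffunE.
Qed.

Lemma tcoord_comp h1 h2 i : T h1 -> T h2 ->
  tcoord i (h1 \o h2)%VF = tcoord i h1 * tcoord i h2.
Proof.
move=> T1 T2; rewrite {1}/tcoord /matrix_coef comp_lfunE.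
have [_ ->] := torus_xbar_e i T2; rewrite linearZ /=.
have [_ ->] := torus_xbar_e i T1.
by rewrite !linearZ /= bcoef_xbar eqxx basis_degree_e mulr1 mulrC.
Qed.

Lemma tcoordV h i : T h -> tcoord i (h^-1)%VF = (tcoord i h)^-1.
Proof.
move=> Th; have [h0 hi] := torus_xbar_e i Th; have [[hinj _] _] := Th.
rewrite {1}/tcoord /matrix_coef -[X in (_^-1)%VF X](scalerK h0) -hi linearZ /=.
by rewrite lker0_lfunK // linearZ /= bcoef_xbar eqxx basis_degree_e mulr1.
Qed.

(** The difficulty is with negative exponents: 1 / t_i is a matrix coefficient of
    h^-1, and so it is regular by Cramer's rule. *)
Lemma tchar_alg_character b : alg_character T (tchar b).
Proof.
split=> [|h Th|h1 h2 T1 T2]; last 1 first.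
- rewrite /tchar -big_split; apply: eq_bigr => i _ /=.
  by rewrite tcoord_comp // exprzMl ?unitfE ?tcoord_neq0.
- apply: regular_prod => i; case: (b i) => j.
    by apply/regularX/regular_polyfun/polyfun_scalar.
  have := regularX j.+1 (regular_scalar_inv (U := T)
    (matrix_coef (e_ i) (xbar I (e_ i))) (fun h Th => Th.1.1)).
  case=> P [r PE]; exists P, r => h Th; rewrite -PE //=.
  by rewrite -/(tcoord i _) tcoordV // exprVn.
exact: tchar_neq0.
Qed.

(** Evaluated on x^b, both sides of h D_p = t^a D_p h equal
    t^(a + b) p(b) x^(a + b). *)
Lemma torus_conj_hder a p h : admissible I a p -> T h ->
  (h \o hder_quot I a p \o h^-1)%VF = hder_quot I a (tchar a h *: p).
Proof.
move=> ap Th; have [[h0 _] _] := Th.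
have tc0 := tchar_neq0 a Th.
have acp : admissible I a (tchar a h *: p).
  move=> m; rewrite -[_ *: p]addr0 N_pairP N_pair0 addr0 mulf_eq0 negb_or tc0.
  exact: ap.
suff hD : (h \o hder_quot I a p = hder_quot I a (tchar a h *: p) \o h)%VF.
  by rewrite hD lker0_compfK.
apply: xbar_ext => m; set b := mnm_deg m; have b0 : inner b := inner_mnm m.
rewrite !comp_lfunE hder_quot_xbar // linearZ /= torus_xbar // linearZ /=.
rewrite hder_quot_xbar // -[_ *: p]addr0 N_pairP N_pair0 addr0.
have [ba|ba] := boolP (inner (b + a)); last first.
  by rewrite (admissible_out ap) // mulr0 !scale0r scaler0.
by rewrite torus_xbar // tcharD // !scalerA mulrC -mulrA.
Qed.

End Torus.

(** * The image of a space of commuting derivations *)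

Section NspaceCoordinates.
Variables (k : fieldType) (n : nat) (I : cofMonIdeal k n).
Implicit Types (a : {ffun 'I_n -> int}) (p : 'rV[k]_n).

(** The indices of the coordinates that span N(a), for inner and outer degrees
    at once. *)
Definition Nindex a : {set 'I_n} :=
  if inner a then Eset I a else [set i | a i == -1].

Lemma NspaceP a p :
  p \in Nspace I a <-> forall i, i \notin Nindex a -> p 0 i = 0.
Proof.
have -> : Nspace I a = (\sum_(i in Nindex a) <[delta_mx 0%R i : 'rV[k]_n]>)%VS.
  by rewrite /Nspace /Nindex; case: ifP => // _; apply: eq_bigl => i; rewrite inE.
split=> [/memv_sumP[v vP ->] i iS | hp].
  rewrite summxE big1 // => j jS; have /vlineP[c ->] := vP j jS.
  by rewrite !mxE eqxx /=; case: eqP => [iE|_]; [rewrite iE jS in iS | rewrite mulr0].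
rewrite (row_sum_delta p) (bigID (mem (Nindex a))) /= addrC big1 => [|i iS].
  by rewrite add0r; apply: memv_sumr => i _; rewrite memvZ ?memv_line.
by rewrite hp // scale0r.
Qed.

End NspaceCoordinates.

Section RootGroup.
Variables (k : fieldType) (n : nat) (I : cofMonIdeal k n).
Hypothesis char0 : [pchar k] =i pred0.
Local Notation A := (mquot I).
Local Notation M := {ffun 'I_n -> int}.
Variable a : M.
Local Notation S := (Nindex I a).
Hypothesis a_neq0 : a != 0.
Implicit Types (p q : 'rV[k]_n) (v : 'rV[k]_#|S|) (f u : 'End(A)).

Local Notation supported p := (p \in Nspace I a).

Hypothesis S_basis : forall i, i \in S -> basis_degree I (a + e_ i).
Hypothesis adm : forall p, supported p -> admissible I a p.

Local Notation D p := (hder_quot I a p).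

Lemma delta_in_Nspace i : i \in S -> supported (delta_mx 0 i).
Proof. by move=> iS; apply/NspaceP => j; rewrite mxE /=; case: eqP => // ->; rewrite iS. Qed.

Lemma rderP c p q : supported p -> supported q -> D (c *: p + q) = c *: D p + D q.
Proof. by move=> hp hq; apply: hder_quotP; apply: adm; rewrite // rpredD ?rpredZ. Qed.

Lemma rder0 : D 0 = 0.
Proof.
have := rderP (-1) (mem0v _) (mem0v _).
by rewrite scaler0 addr0 scaleN1r addNr.
Qed.

Lemma rderZ c p : supported p -> D (c *: p) = c *: D p.
Proof. by move=> hp; rewrite -[_ *: p]addr0 rderP ?rder0 ?addr0 // mem0v. Qed.

Lemma rderD p q : supported p -> supported q -> D (p + q) = D p + D q.
Proof. by move=> hp hq; rewrite -{1}[p]scale1r rderP // scale1r. Qed.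

Lemma rderN p : supported p -> D (- p) = - D p.
Proof. by move=> hp; rewrite -!scaleN1r rderZ. Qed.

Lemma rder_shifts p : supported p -> shifts a (D p).
Proof. by move=> hp; apply/hder_quot_shifts/adm. Qed.

Lemma rder_nilpotent p : supported p -> nilpotent (D p).
Proof. by move=> hp; apply/(shifts_nilpotent a_neq0)/rder_shifts. Qed.

(** In exp(D_p) x_i only the linear term D_p x_i = p_i x^(a + e_i) contributes to
    the degree a + e_i.  So p is recovered linearly from the automorphism. *)
Lemma bcoef_iota p i : supported p -> i \in S ->
  bcoef (a + e_ i) (iota_ I a p (xbar I (e_ i))) = p 0 i.
Proof.
move=> hp iS; rewrite addrC -[a]mulr1n bcoef_nilp_exp //; last exact: rder_shifts.
rewrite invr1 mul1r /= hder_quot_xbar ?inner_e //; last exact: adm.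
by rewrite linearZ /= bcoef_xbar mulr1n eqxx andbT addrC S_basis // mulr1 N_pair_e.
Qed.

Lemma iota_Aut p : supported p -> Aut_alg I (iota_ I a p).
Proof.
move=> hp; split; first exact/(lker0_nilp_exp char0)/rder_nilpotent.
apply: (nilp_exp_ahom char0); first exact: rder_nilpotent.
exact/hder_quot_derivation/adm.
Qed.

(** The coordinates of k^r are matched with the elements of the index set through
    their enumeration. *)
Definition N_embed v : 'rV[k]_n := \sum_j v 0 j *: delta_mx 0 (enum_val j).

Definition N_coord u : 'rV[k]_#|S| :=
  \row_j bcoef (a + e_ (enum_val j)) (u (xbar I (e_ (enum_val j)))).

Lemma N_embedE v j : N_embed v 0 (enum_val j) = v 0 j.
Proof.
rewrite /N_embed summxE (bigD1 j) //= !mxE !eqxx mulr1 big1 ?addr0 // => i ij.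
by rewrite !mxE eqxx (inj_eq enum_val_inj) eq_sym (negbTE ij) mulr0.
Qed.

Lemma N_embed_in v : supported (N_embed v).
Proof.
by apply: rpred_sum => j _; rewrite rpredZ // delta_in_Nspace // enum_valP.
Qed.

Lemma N_embedD v w : N_embed (v + w) = N_embed v + N_embed w.
Proof. by rewrite /N_embed -big_split; apply: eq_bigr => j _ /=; rewrite mxE scalerDl. Qed.

Lemma N_embedZ c v : N_embed (c *: v) = c *: N_embed v.
Proof. by rewrite /N_embed scaler_sumr; apply: eq_bigr => j _ /=; rewrite mxE scalerA. Qed.

Lemma N_coordK p : supported p -> N_embed (N_coord (iota_ I a p)) = p.
Proof.
move=> hp; have /NspaceP p0 := hp; have /NspaceP e0 := N_embed_in (N_coord (iota_ I a p)).
apply/rowP => i; have [iS|iS] := boolP (i \in S); last first.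
  by rewrite p0 // e0.
by rewrite -(enum_rankK_in iS iS) N_embedE mxE bcoef_iota ?enum_valP.
Qed.

Lemma rder_N_embed v : D (N_embed v) = \sum_j v 0 j *: D (delta_mx 0 (enum_val j)).
Proof.
suff [] : supported (N_embed v) /\ D (N_embed v) = \sum_j v 0 j *: D (delta_mx 0 (enum_val j)) by [].
rewrite /N_embed; elim/big_rec2: _ => [|j f p _ [hp Dp]].
  by rewrite mem0v rder0.
have hj := delta_in_Nspace (enum_valP j).
by split; [rewrite rpredD ?rpredZ | rewrite rderP // Dp].
Qed.

(** Stated for a parameter v that is itself a polynomial function, so as to apply
    to k^r and also, through [N_coord], to 'End(A). *)
Lemma polymap_iota N X (x : X -> 'I_N -> k) (v : X -> 'rV[k]_#|S|) :
  (forall j, polyfun x (fun t => v t 0 j)) -> polymap x (fun t => iota_ I a (N_embed (v t))).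
Proof.
move=> vP; apply: polymap_nilp_exp.
apply: (@polymap_ext _ _ _ _ _
  (fun t => \sum_j v t 0 j *: D (delta_mx 0 (enum_val j)))) => [t|].
  by rewrite rder_N_embed.
apply: polymap_sum => j; apply: polymapZ => //; exact: polymap_const.
Qed.

Lemma polyfun_N_coord j : polyfun (@End_coord k A) (fun u => N_coord u 0 j).
Proof.
set i := enum_val j.
apply: polyfun_ext (polyfun_scalar (matrix_coef (a + e_ i) (xbar I (e_ i)))) => u.
by rewrite mxE.
Qed.

(** The image is the fixed locus of a polynomial retraction of 'End(A). *)
Lemma iota_imageP u : iota_image I a u <-> iota_ I a (N_embed (N_coord u)) = u.
Proof.
split=> [[p hp ->] | uE]; first by rewrite N_coordK.
by exists (N_embed (N_coord u)); [exact: N_embed_in | rewrite uE].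
Qed.

Lemma iota_image_closed : zariski_closed_in (Aut_alg I) (iota_image I a).
Proof.
(* the equations are the entries of (exponential of the coordinates of f) - f *)
exists (fun P => exists i, forall f : 'End(A), P.@[End_coord f] =
  End_coord (iota_ I a (N_embed (N_coord f))) i - End_coord f i) => f.
split=> [Uf | [_ PE]].
  split; first by case: Uf => p hp ->; exact: iota_Aut.
  by move=> P [i ->]; have /iota_imageP -> := Uf; rewrite subrr.
apply/iota_imageP/End_coord_inj => i.
have [P hP] : polyfun (@End_coord k A) (fun f : 'End(A) =>
    End_coord (iota_ I a (N_embed (N_coord f))) i - End_coord f i).
  apply: polyfunB; last exact: polyfun_coord.
  exact: (polymap_iota polyfun_N_coord).
apply/eqP; rewrite -subr_eq0 hP; apply/eqP/PE; exists i => g; exact/esym/hP.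
Qed.

Section Commuting.
Hypothesis XnotinI : forall i : 'I_n, 'X_i \notin (I : {pred {mpoly k[n]}}).
Hypothesis rder_comm : forall p q x, supported p -> supported q ->
  D p (D q x) = D q (D p x).

Lemma iotaD p q : supported p -> supported q ->
  iota_ I a (p + q) = (iota_ I a p \o iota_ I a q)%VF.
Proof.
move=> hp hq; rewrite /iota_ rderD // nilp_expD //; try exact: rder_nilpotent.
  by rewrite -rderD //; apply: rder_nilpotent; rewrite rpredD.
by move=> x; apply: rder_comm.
Qed.

Lemma iota_image_subgroup : subgroup_of (Aut_alg I) (iota_image I a).
Proof.
split=> [u [p hp ->]||u w [p hp ->] [q hq ->]|u [p hp ->]].
- exact: iota_Aut.
- by exists 0; [exact: mem0v | rewrite /iota_ rder0 nilp_exp0].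
- by exists (p + q); [rewrite rpredD | rewrite iotaD].
exists (- p); last by rewrite /iota_ rderN // nilp_expV //; exact: rder_nilpotent.
by rewrite rpredN.
Qed.

Lemma torus_conj_iota h p : max_torus I h -> supported p ->
  (h \o iota_ I a p \o h^-1)%VF = iota_ I a (tchar a h *: p).
Proof.
move=> Th hp; rewrite /iota_ nilp_exp_conj ?torus_conj_hder //; first exact: adm.
by case: Th => -[].
Qed.

Lemma iota_image_Ga_iso : Ga_power_iso (iota_image I a) (fun v => iota_ I a (N_embed v)).
Proof.
split=> [|v|v w|].
- have /fin_all_exists[P hP] : forall i, polyfun (fun v : 'rV[k]_#|S| => v 0)
      (fun v => End_coord (iota_ I a (N_embed v)) i).
    by apply: polymap_iota => j; apply: polyfun_coord.
  by exists P => v i; apply: hP.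
- by exists (N_embed v); first exact: N_embed_in.
- by rewrite N_embedD iotaD //; exact: N_embed_in.
exists N_coord; split=> [j|v|u /iota_imageP //].
  exact/regular_polyfun/polyfun_N_coord.
by apply/rowP => j; rewrite mxE bcoef_iota ?enum_valP ?N_embedE //; exact: N_embed_in.
Qed.

(** Conjugation by t multiplies the parameter p by the scalar t^a, in all coordinates
    at once: this is why a single character suffices. *)
Lemma iota_image_gen_root : gen_root_subgroup (Aut_alg I) (max_torus I) (iota_image I a).
Proof.
split; [exact: iota_image_subgroup|exact: iota_image_closed| |].
  move=> h _ Th [p hp ->]; exists (tchar a h *: p); last exact: torus_conj_iota.
  by rewrite rpredZ.
exists #|S|, (fun v => iota_ I a (N_embed v)), (tchar a).
split; [exact: iota_image_Ga_iso | exact: tchar_alg_character |].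
move=> h v Th; rewrite torus_conj_iota ?N_embedZ //; exact: N_embed_in.
Qed.

End Commuting.

(** In degree 2 a + e_i the two products of exponentials have the terms
    D_p^2 / 2 + D_p D_q + D_q^2 / 2 and D_q^2 / 2 + D_q D_p + D_p^2 / 2. *)
Lemma iota_comm_hder p q i : supported p -> supported q ->
    (iota_ I a p \o iota_ I a q)%VF = (iota_ I a q \o iota_ I a p)%VF ->
  bcoef (a + a + e_ i) (D p (D q (xbar I (e_ i)))) =
  bcoef (a + a + e_ i) (D q (D p (xbar I (e_ i)))).
Proof.
move=> hp hq C; have := congr1 (fun f : 'End(A) => bcoef (e_ i + a *+ 2) (f (xbar I (e_ i)))) C.
rewrite !comp_lfunE !bcoef_nilp_exp_comp //; try exact: rder_shifts.
rewrite !big_ord_recl !big_ord0 /= !addr0 mulr2n [e_ i + _]addrC.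
(* the coefficients of the square terms are 1 / 2! on both sides and cancel *)
rewrite -[0`!]/1%N -[(bump 0 0)`!]/1%N !invr1 !mul1r mulr1 -mulr2n.
by rewrite addrCA [RHS]addrCA [X in _ = _ + X]addrC => /addIr.
Qed.

End RootGroup.

(** * Derivations are determined on the variables *)

Section Derivations.
Variables (k : fieldType) (n : nat) (I : cofMonIdeal k n).
Local Notation A := (mquot I).
Local Notation M := {ffun 'I_n -> int}.
Implicit Types (a b : M) (m : 'X_{1..n}) (p q : 'rV[k]_n) (D : 'End(A)).

Lemma xbar0 : xbar I 0 = 1.
Proof.
by rewrite -mnm_deg0 xbar_mnm mpolyX0 rmorph1.
Qed.

(** Every exponent is built from 0 by adding unit vectors. *)
Lemma mnm_ind (P : 'X_{1..n} -> Prop) :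
  P 0%MM -> (forall m i, P m -> P (m + U_(i))%MM) -> forall m, P m.
Proof.
move=> P0 PS m; rewrite [m]multinomUE_id.
elim: (index_enum _) => [|i r IH]; first by rewrite big_nil.
rewrite big_cons addmC; elim: (m i) => [|j IHj]; first by rewrite mulm0n addm0.
by rewrite mulmS [(U_(i) + _)%MM]addmC addmA; apply: PS.
Qed.

(** A derivation that agrees on the variables with the formula
    x^b |-> p(b) x^(b + a) agrees with it on all monomials, by the Leibniz
    rule.  The second hypothesis ensures that x^(b + a) factors as expected
    whenever its coefficient p(b) is nonzero. *)
Lemma derivation_xbar D a p : derivation D ->
    (forall b, inner b -> N_pair p b != 0 -> inner (b + a)) ->
    (forall i, D (xbar I (e_ i)) = p 0 i *: xbar I (e_ i + a)) ->
  forall b, inner b -> D (xbar I b) = N_pair p b *: xbar I (b + a).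
Proof.
move=> DM pa De b b0; rewrite -(deg_mnmK b0); elim/mnm_ind: (deg_mnm b) => [|m i IH].
  rewrite mnm_deg0 xbar0 (leibniz1 DM) /N_pair big1 ?scale0r // => i _.
  by rewrite ffunE mulr0z.
have m0 := inner_mnm m; have i0 := inner_e i.
have half b1 b2 : inner b1 -> inner b2 ->
    N_pair p b1 *: xbar I (b1 + b2 + a) = N_pair p b1 *: xbar I (b1 + a) * xbar I b2.
  move=> b10 b20; have [->|pb1] := eqVneq (N_pair p b1) 0; first by rewrite !scale0r mul0r.
  by rewrite -scalerAl -xbarD ?pa // addrAC.
rewrite mnm_degD mnm_deg1 xbarD // DM IH De N_pair_degD scalerDl half //.
by rewrite [mnm_deg m + e_ i]addrC half // N_pair_e [X in _ + X = _]mulrC.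
Qed.

Lemma derivation_gen0 D : derivation D ->
  (forall i, D (xbar I (e_ i)) = 0) -> D = 0.
Proof.
move=> DM De; apply: xbar_ext => m; rewrite zero_lfunE.
have p0 b : N_pair (0 : 'rV[k]_n) b = 0 by exact: N_pair0.
rewrite (@derivation_xbar D 0 0) ?p0 ?scale0r ?inner_mnm // => [b _|i].
  by rewrite p0 eqxx.
by rewrite De mxE scale0r.
Qed.

Lemma commutator_derivation D1 D2 : derivation D1 -> derivation D2 ->
  derivation ((D1 \o D2)%VF - (D2 \o D1)%VF).
Proof.
move=> D1M D2M x y; rewrite !add_lfunE !opp_lfunE !comp_lfunE D1M D2M !linearD /=.
rewrite !D1M !D2M mulrBl mulrBr -opprD.
(* the mixed terms D1 x * D2 y and D2 x * D1 y occur with both signs *)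
rewrite [X in X - _ = _](AC (2 * 2) ((1 * 4) * (2 * 3)))%AC.
rewrite [X in _ - X = _](AC (2 * 2) ((1 * 4) * (3 * 2)))%AC.
by rewrite opprD addrACA subrr addr0 opprD addrACA.
Qed.

End Derivations.

(** * Roots and commutation of the derivations *)

Section Roots.
Variables (k : fieldType) (n : nat) (I : cofMonIdeal k n).
Hypothesis char0 : [pchar k] =i pred0.
Local Notation A := (mquot I).
Local Notation M := {ffun 'I_n -> int}.
Implicit Types (a b : M) (m : 'X_{1..n}) (p q : 'rV[k]_n).

Lemma intr_char0_eq0 (z : int) : (z%:~R == 0 :> k) = (z == 0).
Proof.
have nat0 j : (j%:R == 0 :> k) = (j == 0%N) by move/pcharf0P: char0 => ->.
by case: z => j; rewrite ?NegzE ?mulrNz ?oppr_eq0 ?nat0.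
Qed.

Lemma N_pair_support1 p i b : (forall j, j != i -> b j != 0 -> p 0 j = 0) ->
  N_pair p b = p 0 i *~ b i.
Proof.
move=> pi; rewrite /N_pair (bigD1 i) //= big1 ?addr0 // => j ji.
by have [->|/(pi j ji) ->] := eqVneq (b j) 0; rewrite ?mulr0z ?mul0rz.
Qed.

Lemma mem_Eset a i : (i \in Eset I a) = basis_degree I (a + e_ i).
Proof. by rewrite inE. Qed.

(** A nonzero derivation D is nonzero on some x_i.  Then D x_i is a multiple of
    x^(a + e_i), so a + e_i has no negative coordinate, and i is the only
    index with a_i < 0.  For j distinct from i the degree a + e_j keeps a negative
    i-th coordinate, and D x_j = 0. *)
Lemma outer_root_index a : is_root I a -> outer a ->
  exists i, [/\ a i = -1, forall j, j != i -> 0 <= a j, basis_degree I (a + e_ i) &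
    exists2 D : 'End(A), derivation D &
      exists2 c : k, c != 0 & forall j, D (xbar I (e_ j)) = (c * (j == i)%:R) *: xbar I (e_ j + a)].
Proof.
move=> [a0 [D [DM /homogeneous_shifts Dh Dn0]]] a_out.
have /existsP[i Di] : [exists i, D (xbar I (e_ i)) != 0].
  apply: contraNT Dn0; rewrite negb_exists => /forallP D0.
  by apply/eqP/derivation_gen0 => // i; apply/eqP; rewrite -[_ == _]negbK.
have [c Dc] := Dh (e_ i); rewrite Dc scaler_eq0 negb_or xbar_eq0 negbK addrC in Di.
have /andP[c0 bi] := Di; have /andP[/innerP ai _] := bi.
have ge0 j : j != i -> 0 <= a j.
  by move=> ji; have := ai j; rewrite !ffunE (negbTE ji) addr0.
have aiE : a i = -1.
  have [j aj] : exists j, ~~ (0 <= a j) by apply/existsP; rewrite -negb_forall.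
  have ji : j = i by apply/eqP; apply: contraNT aj; apply: ge0.
  rewrite ji in aj; have := ai i; rewrite !ffunE eqxx.
  by case: (a i) aj => [|[|]].
exists i; split=> //; exists D => //; exists c => // j.
have [->|ji] := eqVneq j i; first by rewrite mulr1 Dc.
rewrite mulr0 scale0r; have [c' ->] := Dh (e_ j).
rewrite xbar_out ?scaler0 //; apply/negP => /innerP/(_ i).
by rewrite !ffunE aiE eq_sym (negbTE ji).
Qed.

(** The derivation D that witnesses the root is a nonzero multiple of
    x^m |-> m_i x^(m + a).  For m in supp(I), x^m is zero in A, hence so is
    m_i x^(m + a); in characteristic zero, m_i can be cancelled. *)
Lemma outer_root_admissible a : is_root I a -> outer a ->
  exists i, [/\ Nindex I a = [set i], basis_degree I (a + e_ i) &
    forall p, p \in Nspace I a -> admissible I a p].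
Proof.
move=> a_root a_out.
have [i [ai aj bi [D DM [c c0 Dc]]]] := outer_root_index a_root a_out.
have iE : Nindex I a = [set i].
  apply/setP => j; rewrite /Nindex (negbTE a_out) !inE.
  by have [->|/aj] := eqVneq j i; [rewrite ai eqxx | case: (a j)].
have pairE p b : p \in Nspace I a -> N_pair p b = p 0 i *~ b i.
  move=> /NspaceP pi; apply: N_pair_support1 => j ji _; apply: pi.
  by rewrite iE inE.
exists i; split=> // p pN m; rewrite pairE // => pm.
have {pm}mi : (mnm_deg m i != 0) by apply: contraNneq pm => ->; rewrite mulr0z.
have inn b : inner b -> b i != 0 -> inner (b + a).
  move=> /innerP b0 bi0; apply/innerP => j; rewrite ffunE.
  have [->|/aj] := eqVneq j i; last by apply: addr_ge0.
  by rewrite ai; move: (b0 i) bi0; case: (b i) => [[]|].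
split; first exact: inn (inner_mnm m) mi.
move=> mI; pose q : 'rV[k]_n := c *: delta_mx 0 i.
have qN : q \in Nspace I a.
  by apply/NspaceP => j; rewrite iE inE !mxE => /negbTE ->; rewrite andbF mulr0.
have qi : q 0 i = c by rewrite !mxE !eqxx mulr1.
have qa b : inner b -> N_pair q b != 0 -> inner (b + a).
  by move=> b0; rewrite pairE // => qb; apply: inn => //; apply: contraNneq qb => ->.
have De j : D (xbar I (e_ j)) = q 0 j *: xbar I (e_ j + a) by rewrite Dc !mxE eqxx.
have := derivation_xbar DM qa De (inner_mnm m); rewrite pairE // qi.
have /eqP -> : xbar I (mnm_deg m) == 0 by rewrite xbar_eq0 basis_degree_mnm negbK.
rewrite linear0 => /esym/eqP; rewrite scaler_eq0 -mulrzr mulf_eq0 (negbTE c0).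
by rewrite intr_char0_eq0 (negbTE mi) => /eqP.
Qed.

Lemma hder_comp_e a p q i : inner a ->
  hder_quot I a p (hder_quot I a q (xbar I (e_ i))) =
  (q 0 i * (p 0 i + N_pair p a)) *: xbar I (a + a + e_ i).
Proof.
move=> a0; have ap p' := @admissible_inner _ _ I a p' a0.
have ei := inner_e i; rewrite hder_quot_xbar // linearZ /= hder_quot_xbar ?innerD //.
by rewrite scalerA !N_pair_e N_pair_degD N_pair_e -[e_ i + a + a]addrA [e_ i + (a + a)]addrC.
Qed.

Lemma Eset_plus_pair a i p : inner a -> Eset_plus I a = [set i] ->
  p \in Nspace I a -> N_pair p a = p 0 i *~ a i.
Proof.
move=> a0 Ei /NspaceP pN; apply: N_pair_support1 => j ji aj; apply: pN.
rewrite /Nindex a0; apply: contra ji => jE.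
by rewrite -in_set1 -Ei in_set jE.
Qed.

(** The commutator of D_p and D_q is a derivation, so it suffices that it kills
    the variables.  It sends x_i to a multiple of x^(2 a + e_i), which is zero unless
    i lies in E_(2a); then the hypothesis makes p(a) and q(a) proportional to
    p_i and q_i with the same factor a_i. *)
Lemma inner_comm a p q x : inner a ->
    Eset I (a + a) = set0 \/
      (exists i, Eset I (a + a) = [set i] /\ Eset_plus I a = [set i]) ->
    p \in Nspace I a -> q \in Nspace I a ->
  hder_quot I a p (hder_quot I a q x) = hder_quot I a q (hder_quot I a p x).
Proof.
move=> a0 hE pN qN; set Dp := hder_quot I a p; set Dq := hder_quot I a q.
have ap p' := @admissible_inner _ _ I a p' a0.
suff /eqP : ((Dp \o Dq)%VF - (Dq \o Dp)%VF) = 0.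
  by rewrite subr_eq0 => /eqP/lfunP/(_ x); rewrite !comp_lfunE.
apply: derivation_gen0 => [|i].
  by apply: commutator_derivation; apply: hder_quot_derivation.
rewrite add_lfunE opp_lfunE !comp_lfunE !hder_comp_e // -scalerBl.
have [iE|] := boolP (i \in Eset I (a + a)); last first.
  by rewrite mem_Eset -xbar_eq0 => /eqP ->; rewrite scaler0.
case: hE iE => [->|[j [-> Ej]]]; rewrite inE // => /eqP ->.
rewrite !(Eset_plus_pair a0 Ej) // !mulrDr !mulrzAr [q 0 j * p 0 j]mulrC subrr.
by rewrite scale0r.
Qed.

(** If i is in E_(2a) and a_l is nonzero, then x^(a + e_l) divides
    x^(2 a + e_i), because a_l >= 1; hence l is in E_a.  As a is nonzero there is such
    an l, and the hypothesis leaves only l = i. *)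
Lemma Eset2_combinatorics a : a != 0 -> inner a ->
    (forall i j, i \in Eset I (a + a) -> j \in Eset I a -> j != i -> a j = 0) ->
  Eset I (a + a) = set0 \/
    exists i, Eset I (a + a) = [set i] /\ Eset_plus I a = [set i].
Proof.
move=> a_neq0 a0 hE; have [->|[i0 i0E]] := set_0Vmem (Eset I (a + a)); [by left | right].
have [j aj] := deg_neq0P a_neq0.
have supp_sub l i : i \in Eset I (a + a) -> a l != 0 -> l \in Eset I a.
  rewrite !mem_Eset -[basis_degree I (a + e_ l)]negbK -xbar_eq0 => iE al.
  apply: contraTN iE => /eqP xl; rewrite -xbar_eq0.
  (* the cofactor a - e_l + e_i has no negative coordinate since a_l >= 1 *)
  have -> : a + a + e_ i = (a + e_ l) + (a - e_ l + e_ i).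
    by rewrite -!addrA [e_ l + _]addrCA [e_ l + (- _ + _)]addrA subrr add0r.
  rewrite xbarD ?xl ?mul0r //; first by rewrite innerD ?inner_e.
  apply: innerD (inner_e i); apply/innerP => r; rewrite !ffunE subr_ge0.
  have /innerP/(_ r) := a0; case: eqP => [->|_] //.
  by case: (a l) al => [[]|].
have jE i : i \in Eset I (a + a) -> j = i.
  move=> iE; apply/eqP/negPn/negP => ji.
  by have := aj; rewrite (hE i j iE (supp_sub j i iE aj) ji) eqxx.
exists j; split; apply/setP => i; rewrite in_set1.
  by apply/idP/eqP => [/jE->//|->]; rewrite (jE i0).
rewrite in_set; apply/andP/eqP => [[iE ai]|->]; last first.
  by split=> //; apply: (supp_sub j i0).
apply/eqP; apply: contraNT ai => ij.
by rewrite (hE i0 i i0E iE) // -(jE i0 i0E).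
Qed.

End Roots.

(** * The two directions *)

(** The additive group k^r is commutative. *)
Lemma gen_root_subgroup_comm (k : fieldType) (V : vectType k) (G H U : 'End(V) -> Prop)
    (u w : 'End(V)) :
  gen_root_subgroup G H U -> U u -> U w -> (u \o w)%VF = (w \o u)%VF.
Proof.
case=> _ _ _ [r [phi [chi [[_ _ phiD [psi [_ _ psiK]]] _ _]]]] Uu Uw.
by rewrite -(psiK u Uu) -(psiK w Uw) -!phiD addrC.
Qed.

(** Take p = e_i^* and q = e_j^*: then q_i = 0, while p_i q(a) = a_j is the
    coefficient of D_q D_p x_i at x^(2 a + e_i). *)
Lemma inner_gen_root_vanishing (k : fieldType) (n : nat) (I : cofMonIdeal k n)
    (a : {ffun 'I_n -> int}) i j :
    [pchar k] =i pred0 -> a != 0 -> inner a ->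
    gen_root_subgroup (Aut_alg I) (max_torus I) (iota_image I a) ->
  i \in Eset I (a + a) -> j \in Eset I a -> j != i -> a j = 0.
Proof.
move=> char0 a_neq0 a0 gen iE2 jE ji.
have SE : Nindex I a = Eset I a by rewrite /Nindex a0.
have iE : i \in Eset I a.
  move: iE2; rewrite !mem_Eset; apply: contraTT; rewrite -!xbar_eq0 => /eqP x0.
  by rewrite -addrA xbarD ?innerD ?inner_e // x0 mulr0.
have N l : l \in Eset I a -> delta_mx 0 l \in Nspace I a.
  by rewrite -SE; apply: delta_in_Nspace.
have adm p : p \in Nspace I a -> admissible I a p by move=> _; apply: admissible_inner.
have /(iota_comm_hder a_neq0 adm i (N i iE) (N j jE)) :
    (iota_ I a (delta_mx 0 i) \o iota_ I a (delta_mx 0 j) =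
     iota_ I a (delta_mx 0 j) \o iota_ I a (delta_mx 0 i))%VF.
  by apply: (gen_root_subgroup_comm gen); [exists (delta_mx 0 i) | exists (delta_mx 0 j)]; rewrite ?N.
rewrite !hder_comp_e // !linearZ /= bcoef_xbar -mem_Eset iE2 eqxx !mulr1.
rewrite !mxE !eqxx /= eq_sym (negbTE ji) mul0r mul1r add0r => /esym/eqP.
rewrite (N_pair_support1 (i := j)) => [|l lj _]; last by rewrite mxE (negbTE lj).
by rewrite mxE !eqxx intr_char0_eq0 // => /eqP.
Qed.

(** For an outer root N(a) is a line, and multiples of one operator commute. *)
Lemma outer_root_gen (k : fieldType) (n : nat) (I : cofMonIdeal k n)
    (a : {ffun 'I_n -> int}) :
    [pchar k] =i pred0 -> (forall i : 'I_n, 'X_i \notin (I : {pred {mpoly k[n]}})) ->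
    is_root I a -> outer a ->
  gen_root_subgroup (Aut_alg I) (max_torus I) (iota_image I a).
Proof.
move=> char0 XnotinI a_root a_out.
have [i [SE bi adm]] := outer_root_admissible char0 a_root a_out.
apply: iota_image_gen_root => //; first by case: a_root.
  by move=> j; rewrite SE inE => /eqP ->.
have line p : p \in Nspace I a -> p = p 0 i *: delta_mx 0 i.
  move/NspaceP; rewrite SE => pN; apply/rowP => j; rewrite !mxE eqxx /=.
  by have [->|ji] := eqVneq j i; rewrite ?mulr1 // mulr0 pN // inE.
have dN : delta_mx 0 i \in Nspace I a by apply: delta_in_Nspace; rewrite SE inE.
move=> p q x /line -> /line ->; rewrite !rderZ // !scale_lfunE !linearZ /=.
by rewrite !scalerA mulrC.
Qed.

Lemma inner_root_gen (k : fieldType) (n : nat) (I : cofMonIdeal k n)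
    (a : {ffun 'I_n -> int}) :
    [pchar k] =i pred0 -> (forall i : 'I_n, 'X_i \notin (I : {pred {mpoly k[n]}})) ->
    a != 0 -> inner a ->
    Eset I (a + a) = set0 \/
      (exists i, Eset I (a + a) = [set i] /\ Eset_plus I a = [set i]) ->
  gen_root_subgroup (Aut_alg I) (max_torus I) (iota_image I a).
Proof.
move=> char0 XnotinI a_neq0 a0 hE.
apply: iota_image_gen_root => // [i|p _|p q x pN qN].
- by rewrite /Nindex a0 mem_Eset.
- exact: admissible_inner.
exact: inner_comm.
Qed.

Unset Implicit Arguments.

Theorem proposition2p3 (k : closedFieldType) (char0 : [pchar k] =i pred0)
    (n : nat) (n_gt0 : (0 < n)%N) (I : cofMonIdeal k n)
    (XnotinI : forall i : 'I_n, 'X_i \notin (I : {pred {mpoly k[n]}}))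
    (alpha : {ffun 'I_n -> int}) (alpha_root : is_root I alpha) :
  gen_root_subgroup (Aut_alg I) (max_torus I) (iota_image I alpha)
  <->
  outer alpha \/
  (inner alpha /\
   (Eset I (alpha + alpha) = set0 \/
    exists i0 : 'I_n,
      Eset I (alpha + alpha) = [set i0] /\ Eset_plus I alpha = [set i0])).
Proof.
have alpha_neq0 : alpha != 0 by case: alpha_root.
split=> [gen | [alpha_out | [alpha_in hE]]].
- have [alpha_in|alpha_out] := boolP (inner alpha); [right; split=> // | by left].
  apply: Eset2_combinatorics => // i j; exact: inner_gen_root_vanishing.
- exact: outer_root_gen.
exact: inner_root_gen.
Qed.
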